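(* For every valid machine configuration $\varsigma$ and every configuration $\varsigma'$ with $\varsigma\mapsto\varsigma'$, we have $\mathcal{T}(\varsigma)\to^*_{\mathrm{CAU}^-_\sigma}\mathcal{T}(\varsigma')$, where $\mathcal{T}$ is the denotation of term configurations.
   Context: The calculus $\mathrm{CAU}^-_\sigma$ uses nameless (de Bruijn) syntax: Terms $M,N ::= 1 \mid \lambda.M \mid M\,N \mid \mathsf{let}(M,N) \mid !_q M \mid q \triangleright M \mid \iota(\vartheta) \mid M[s] \mid \mathrm{er}(M)$; Trails $q ::= \mathsf{r} \mid \mathsf{t}(q,q') \mid \mathsf{ba} \mid \mathsf{bb} \mid \mathsf{ti} \mid \mathsf{lam}(q) \mid \mathsf{app}(q,q') \mid \mathsf{let}(q,q') \mid \mathsf{tr}(\zeta) \mid \mathrm{tl}(M)$; Substitutions $s,t ::= \langle\rangle \mid {\uparrow} \mid M\cdot s \mid s\circ t$. Index $1$; $\lambda$ binds index 1 of its body; $\mathsf{let}(M,N)$ binds index 1 in $N$; $\vartheta=\{M_1,\dots,M_9\}$ (resp. $\zeta$) is a family of nine terms (resp. trails) indexed by the trail constructors in the order $\mathsf{r},\mathsf{t},\mathsf{ba},\mathsf{bb},\mathsf{ti},\mathsf{lam},\mathsf{app},\mathsf{let},\mathsf{tr}$. $\mathrm{er}$ is explicit trail erasure, $\mathrm{tl}$ explicit trail extraction, $M[s]$ explicit substitution. ${\uparrow}^n={\uparrow}\circ\cdots\circ{\uparrow}$; index $n+1$ is $1[{\uparrow}^n]$; $M[N_1\cdots N_k]$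 abbreviates $M[N_1\cdot\ldots\cdot N_k\cdot\langle\rangle]$; $!M$ abbreviates $!_{\mathsf{r}}M$. $\sigma$-rules: $1[\langle\rangle]\to 1$; $1[M\cdot s]\to M$; $(\lambda.M)[s]\to \lambda.(M[1\cdot(s\circ{\uparrow})])$; $(M\,N)[s]\to M[s]\,N[s]$; $(!_qM)[s]\to !_q(M[s])$; $\mathsf{let}(M,N)[s]\to\mathsf{let}(M[s],N[1\cdot(s\circ{\uparrow})])$; $(q\triangleright M)[s]\to q\triangleright(M[s])$; $\iota(\{M_i\})[s]\to\iota(\{M_i[s]\})$; $M[s][t]\to M[s\circ t]$; $\langle\rangle\circ s\to s$; ${\uparrow}\circ\langle\rangle\to{\uparrow}$; ${\uparrow}\circ(M\cdot s)\to s$; $(M\cdot s)\circ t\to M[t]\cdot(s\circ t)$; $(s_1\circ s_2)\circ s_3\to s_1\circ(s_2\circ s_3)$; $\mathrm{er}(1)\to 1$; $\mathrm{er}(1[{\uparrow}^n])\to 1[{\uparrow}^n]$; $\mathrm{er}(\lambda.M)\to\lambda.\mathrm{er}(M)$; $\mathrm{er}(M\,N)\to\mathrm{er}(M)\,\mathrm{er}(N)$; $\mathrm{er}(!_qM)\to !_qM$; $\mathrm{er}(\mathsf{let}(M,N))\to\mathsf{let}(\mathrm{er}(M),\mathrm{er}(N))$; $\mathrm{er}(q\triangleright M)\to\mathrm{er}(M)$; $\mathrm{er}(\iota(\{M_i\}))\to\iota(\{\mathrm{er}(M_i)\})$; $\mathrm{tl}(1)\to\mathsf{r}$; $\mathrm{tl}(1[{\uparrow}^n])\to\mathsf{r}$;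 $\mathrm{tl}(\lambda.M)\to\mathsf{lam}(\mathrm{tl}(M))$; $\mathrm{tl}(M\,N)\to\mathsf{app}(\mathrm{tl}(M),\mathrm{tl}(N))$; $\mathrm{tl}(!_qM)\to\mathsf{r}$; $\mathrm{tl}(\mathsf{let}(M,N))\to\mathsf{let}(\mathrm{tl}(M),\mathrm{tl}(N))$; $\mathrm{tl}(q\triangleright M)\to\mathsf{t}(q,\mathrm{tl}(M))$; $\mathrm{tl}(\iota(\{M_i\}))\to\mathsf{tr}(\{\mathrm{tl}(M_i)\})$. $\tau$-rules: $\mathsf{r}\triangleright M\to M$; $q\triangleright(q'\triangleright M)\to\mathsf{t}(q,q')\triangleright M$; $!_q(q'\triangleright M)\to !_{\mathsf{t}(q,q')}M$; $\lambda.(q\triangleright M)\to\mathsf{lam}(q)\triangleright\lambda.M$; $(q\triangleright M)\,N\to\mathsf{app}(q,\mathsf{r})\triangleright M\,N$; $M\,(q\triangleright N)\to\mathsf{app}(\mathsf{r},q)\triangleright M\,N$; $\mathsf{let}(q\triangleright M,N)\to\mathsf{let}(q,\mathsf{r})\triangleright\mathsf{let}(M,N)$; $\mathsf{let}(M,q\triangleright N)\to\mathsf{let}(\mathsf{r},q)\triangleright\mathsf{let}(M,N)$; $\iota(\{M_1,\dots,q\triangleright M_i,\dots,M_9\})\to\mathsf{tr}(\{\mathsf{r},\dots,q,\dots,\mathsf{r}\})\triangleright\iota(\{M_1,\dots,M_9\})$; $\mathsf{t}(q,\mathsf{r})\to q$; $\mathsf{t}(\mathsf{r},q)\to q$; $\mathsf{tr}(\{\mathsf{r},\dots,\mathsf{r}\})\to\mathsf{r}$;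 $\mathsf{app}(\mathsf{r},\mathsf{r})\to\mathsf{r}$; $\mathsf{lam}(\mathsf{r})\to\mathsf{r}$; $\mathsf{let}(\mathsf{r},\mathsf{r})\to\mathsf{r}$; $\mathsf{t}(\mathsf{t}(q_1,q_2),q_3)\to\mathsf{t}(q_1,\mathsf{t}(q_2,q_3))$; $\mathsf{t}(\mathsf{lam}(q),\mathsf{lam}(q'))\to\mathsf{lam}(\mathsf{t}(q,q'))$; $\mathsf{t}(\mathsf{lam}(q_1),\mathsf{t}(\mathsf{lam}(q_1'),q))\to\mathsf{t}(\mathsf{lam}(\mathsf{t}(q_1,q_1')),q)$; $\mathsf{t}(\mathsf{app}(q_1,q_2),\mathsf{app}(q_1',q_2'))\to\mathsf{app}(\mathsf{t}(q_1,q_1'),\mathsf{t}(q_2,q_2'))$; $\mathsf{t}(\mathsf{app}(q_1,q_2),\mathsf{t}(\mathsf{app}(q_1',q_2'),q))\to\mathsf{t}(\mathsf{app}(\mathsf{t}(q_1,q_1'),\mathsf{t}(q_2,q_2')),q)$; the same two with $\mathsf{let}$ for $\mathsf{app}$; $\mathsf{t}(\mathsf{tr}(\{q_i\}),\mathsf{tr}(\{q_i'\}))\to\mathsf{tr}(\{\mathsf{t}(q_i,q_i')\})$; $\mathsf{t}(\mathsf{tr}(\{q_i\}),\mathsf{t}(\mathsf{tr}(\{q_i'\}),q))\to\mathsf{t}(\mathsf{tr}(\{\mathsf{t}(q_i,q_i')\}),q)$. Both apply anywhere; $\sigma\cup\tau$ is terminating and confluent, $\sigma\tau(X)$ is the normal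 form, $\equiv_{\sigma\tau}$ the equivalence closure. For a trail $q$ without $\mathrm{tl}$: $\mathsf{r}\vartheta=\vartheta(\mathsf{r})$, $\mathsf{ba}\vartheta=\vartheta(\mathsf{ba})$, $\mathsf{bb}\vartheta=\vartheta(\mathsf{bb})$, $\mathsf{ti}\vartheta=\vartheta(\mathsf{ti})$, $\mathsf{lam}(q)\vartheta=\vartheta(\mathsf{lam})\,(q\vartheta)$, $c(q,q')\vartheta=\vartheta(c)\,(q\vartheta)\,(q'\vartheta)$ for $c\in\{\mathsf{t},\mathsf{app},\mathsf{let}\}$, $\mathsf{tr}(\{q_1,\dots,q_9\})\vartheta=\vartheta(\mathsf{tr})\,(q_1\vartheta)\cdots(q_9\vartheta)$. Beta-reduction: with $F ::= \blacksquare \mid \lambda.F \mid F\,N \mid M\,F \mid \mathsf{let}(F,N) \mid \mathsf{let}(M,F) \mid q\triangleright F \mid \iota(\{\vec M,F,\vec N\}) \mid F[s]$: $(\lambda.M)\,N\to_{\mathrm{Beta}}\mathsf{t}(\mathsf{app}(\mathsf{lam}(\mathrm{tl}(M)),\mathrm{tl}(N)),\mathsf{ba})\triangleright\mathrm{er}(M)[\mathrm{er}(N)]$; $\mathsf{let}(!_qM,N)\to_{\mathrm{Beta}}\mathsf{t}(\mathsf{let}(\mathsf{r},\mathrm{tl}(N)),\mathsf{bb})\triangleright\mathrm{er}(N)[q\triangleright M]$; $!_qF[\iota(\vartheta)]\to_{\mathrm{Beta}}!_qF[\mathsf{ti}\triangleright q'\vartheta]$ with $q'=\sigma\tau(\mathsf{t}(q,\mathrm{tl}(F[\iota(\vartheta)])))$;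 closed under $E_\sigma ::= \blacksquare \mid \lambda.E_\sigma \mid E_\sigma\,N \mid M\,E_\sigma \mid \mathsf{let}(E_\sigma,N) \mid \mathsf{let}(M,E_\sigma) \mid !_qE_\sigma \mid q\triangleright E_\sigma \mid \iota(\{\vec M,E_\sigma,\vec N\}) \mid E_\sigma[s] \mid M[S_\sigma]$, $S_\sigma ::= S_\sigma\circ t \mid s\circ S_\sigma \mid E_\sigma\cdot s \mid M\cdot S_\sigma$. $\to_{\mathrm{CAU}^-_\sigma}\;=\;\to_{\mathrm{Beta}}\cup\equiv_{\sigma\tau}$. Abstract machine. Pure terms $M$ are terms built from de Bruijn indices $n$ (index $n$ is $1[{\uparrow}^{n-1}]$), $\lambda$, application, $\mathsf{let}$, $!_q$ (with $q$ not containing $\mathrm{tl}$), $q\triangleright$ and $\iota$, with no explicit substitution or erasure. Closures $C ::= \mathrm{er}((\lambda.M)[e]) \mid !_qC$; values $V,W ::= q\triangleright C$ (additionally, as in the machine rules 5 and 7 below, a term $q\triangleright !V$ with $V$ a value is treated as a value); environments $e ::= \langle\rangle \mid V\cdot e$. Codes $\kappa ::= M \mid @ \mid ! \mid \mathsf{let}(M) \mid \iota$; tuples $(q|\kappa|e)$; a stack $\pi$ is a list of tuples, a dump $D$ a list of values ($\epsilon$ is the empty list, $::$ cons); a configuration is a pair $(\pi,D)$. $q_1;q_2;\dots;q_n$ abbreviates $\mathsf{t}(\cdots\mathsf{t}(q_1,q_2)\cdots,q_n)$. Context configurations $\vdash_{ctx}$: $\vdash_{ctx}(\epsilon,\epsilon)$;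 and if $\vdash_{ctx}(\pi,D)$ then $\vdash_{ctx}((q|M|e)::(q'|@|\langle\rangle)::\pi,D)$, $\vdash_{ctx}((q|@|\langle\rangle)::\pi,V::D)$, $\vdash_{ctx}((q|\mathsf{let}(M)|e)::\pi,D)$, $\vdash_{ctx}((q|!|\langle\rangle)::\pi,D)$, and $\vdash_{ctx}((q_{k+1}|M_{k+1}|e_{k+1})::\cdots::(q_9|M_9|e_9)::(q'|\iota|\langle\rangle)::\pi,\;V_1::\cdots::V_{k-1}::D)$ for $1\le k\le 9$. Term configurations $\vdash_{tm}$: $\vdash_{tm}(\epsilon,V::\epsilon)$; and if $\vdash_{ctx}(\pi,D)$ then $\vdash_{tm}((q|M|e)::\pi,D)$, $\vdash_{tm}((q|@|\langle\rangle)::\pi,W::V::D)$, $\vdash_{tm}((q|\mathsf{let}(M)|e)::\pi,V::D)$, $\vdash_{tm}((q|!|\langle\rangle)::\pi,V::D)$, $\vdash_{tm}((q|\iota|\langle\rangle)::\pi,V_1::\cdots::V_9::D)$. Denotation of context configurations (a context with hole $\blacksquare$; $\mathcal{C}[X]$ is hole-filling): $\underline{(\epsilon,\epsilon)}=\blacksquare$; $\underline{((q|M|e)::(q'|@|\langle\rangle)::\pi,D)}=\underline{(\pi,D)}[q'\triangleright(\blacksquare\,(q\triangleright\mathrm{er}(M[e])))]$; $\underline{((q|@|\langle\rangle)::\pi,V::D)}=\underline{(\pi,D)}[q\triangleright(V\,\blacksquare)]$; $\underline{((q|\mathsf{let}(M)|e)::\pi,D)}=\underline{(\pi,D)}[q\triangleright\mathsf{let}(\blacksquare,\mathrm{er}(M[1\cdot(e\circ{\uparrow})]))]$;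 $\underline{((q|!|\langle\rangle)::\pi,D)}=\underline{(\pi,D)}[q\triangleright !\blacksquare]$; $\underline{((q_{k+1}|M_{k+1}|e_{k+1})::\cdots::(q_9|M_9|e_9)::(q'|\iota|\langle\rangle)::\pi,V_1::\cdots::V_{k-1}::D)}=\underline{(\pi,D)}[q'\triangleright\iota(V_1,\dots,V_{k-1},\blacksquare,q_{k+1}\triangleright\mathrm{er}(M_{k+1}[e_{k+1}]),\dots,q_9\triangleright\mathrm{er}(M_9[e_9]))]$. Denotation of term configurations: $\mathcal{T}(\epsilon,V::\epsilon)=V$; $\mathcal{T}((q|M|e)::\pi,D)=\underline{(\pi,D)}[q\triangleright\mathrm{er}(M[e])]$; $\mathcal{T}((q|@|\langle\rangle)::\pi,W::V::D)=\underline{(\pi,D)}[q\triangleright(V\,W)]$; $\mathcal{T}((q|\mathsf{let}(M)|e)::\pi,V::D)=\underline{(\pi,D)}[q\triangleright\mathsf{let}(V,\mathrm{er}(M[1\cdot(e\circ{\uparrow})]))]$; $\mathcal{T}((q|!|\langle\rangle)::\pi,V::D)=\underline{(\pi,D)}[q\triangleright !V]$; $\mathcal{T}((q|\iota|\langle\rangle)::\pi,V_1::\cdots::V_9::D)=\underline{(\pi,D)}[q\triangleright\iota(V_1,\dots,V_9)]$. A configuration $(\pi,D)$ is valid if $\vdash_{tm}(\pi,D)$, for every tuple $(q|M|e)$ in $\pi$ with $M$ a pure term, $M[e]$ is closed and all values in $e$ are closed, and all values in $D$ are closed. Auxiliary operations: $e(n)=C$ if $e=(q\triangleright C)\cdot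 e'$ and $n=1$; $e(n)=e'(m)$ if $e=V\cdot e'$ and $n=m+1$. Trail materialization $\mathcal{I}$ (partial): $\mathcal{I}(q_\vartheta,(q'|!|\epsilon)::\pi,D)=\sigma\tau(q_\vartheta)$; $\mathcal{I}(q_\vartheta,(q'|M|e)::(q''|@|\epsilon)::\pi,D)=\mathcal{I}((q'';\mathsf{app}(q_\vartheta,q')),\pi,D)$; $\mathcal{I}(q_\vartheta,(q'|@|\langle\rangle)::\pi,(q''\triangleright C)::D)=\mathcal{I}((q';\mathsf{app}(q'',q_\vartheta)),\pi,D)$; $\mathcal{I}(q_\vartheta,(q'|\mathsf{let}(M)|e)::\pi,D)=\mathcal{I}((q';\mathsf{let}(q_\vartheta,\mathsf{r})),\pi,D)$; $\mathcal{I}(q_\vartheta,(q_{k+1}|M_{k+1}|e_{k+1})::\cdots::(q_9|M_9|e_9)::(q'|\iota|\langle\rangle)::\pi,(q_1\triangleright C_1)::\cdots::(q_{k-1}\triangleright C_{k-1})::D)=\mathcal{I}((q';\mathsf{tr}(q_1,\dots,q_{k-1},q_\vartheta,q_{k+1},\dots,q_9)),\pi,D)$; undefined on $(\epsilon,\epsilon)$. A $\sigma\tau$-normal trail is encoded as a pure term $\ulcorner q\urcorner$ with free indices among $1,\dots,9$ by replacing the $i$-th constructor in the order $\mathsf{r},\mathsf{t},\mathsf{ba},\mathsf{bb},\mathsf{ti},\mathsf{lam},\mathsf{app},\mathsf{let},\mathsf{tr}$ by index $i$ and constructor application by term application. Transitions $\mapsto$: (1) $((q|M\,N|e)::\pi,D)\mapsto((\mathsf{r}|M|e)::(\mathsf{r}|N|e)::(q|@|\langle\rangle)::\pi,D)$;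 (2) $((q|@|\langle\rangle)::\pi,(q'\triangleright C)::(q''\triangleright\mathrm{er}((\lambda.M)[e]))::D)\mapsto((q;\mathsf{app}(q'',q');\mathsf{ba}|M|(\mathsf{r}\triangleright C)\cdot e)::\pi,D)$; (3) $((q|\lambda.M|e)::\pi,D)\mapsto(\pi,(q\triangleright\mathrm{er}((\lambda.M)[e]))::D)$; (4) $((q|\mathsf{let}(M,N)|e)::\pi,D)\mapsto((\mathsf{r}|M|e)::(q|\mathsf{let}(N)|e)::\pi,D)$; (5) $((q|\mathsf{let}(N)|e)::\pi,(q'\triangleright !V)::D)\mapsto((q;\mathsf{let}(q',\mathsf{r});\mathsf{bb};\mathrm{tl}(\mathrm{er}(N[1\cdot(e\circ{\uparrow})])[V])|N|V\cdot e)::\pi,D)$; (6) $((q|!_{q'}M|e)::\pi,D)\mapsto((q';\mathrm{tl}(M[e])|M|e)::(q|!|\langle\rangle)::\pi,D)$; (7) $((q|!|\langle\rangle)::\pi,V::D)\mapsto(\pi,(q\triangleright !V)::D)$; (8) $((q|\iota(\{M_1,\dots,M_9\})|e)::\pi,D)\mapsto((\mathsf{r}|M_1|e)::\cdots::(\mathsf{r}|M_9|e)::(q|\iota|\langle\rangle)::\pi,D)$; (9) $((q|\iota|\langle\rangle)::\pi,(q_1\triangleright C_1)::\cdots::(q_9\triangleright C_9)::D)\mapsto((q;\mathsf{tr}(q_1,\dots,q_9);\mathsf{ti}\,|\,\ulcorner\mathcal{I}((q;\mathsf{tr}(q_1,\dots,q_9)),\pi,D)\urcorner\,|\,(\mathsf{r}\triangleright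 C_1)\cdot\ldots\cdot(\mathsf{r}\triangleright C_9)\cdot\langle\rangle)::\pi,D)$, provided $\mathcal{I}$ is defined; (10) $((q|n|e)::\pi,D)\mapsto(\pi,(q\triangleright e(n))::D)$ for a de Bruijn index $n$.
   Formalization: The dump blocks V_1::…::V_{k-1}::D and V_1::…::V_9::D for ι (in ⊢ctx, ⊢tm, both denotations, I and rule 9) are read in reverse, last computed value on top, since with the order as written rule 3 permutes the components of ι and the claim fails. *)

(* Defs.v *)
From Stdlib Require Import List Relations Arith Lia.
Import ListNotations.

(** * Syntax *)

(** The trail constructors; they index the families [theta] and [zeta]. *)
Inductive tcon : Type :=
  c_r | c_t | c_ba | c_bb | c_ti | c_lam | c_app | c_let | c_tr.

Record nine (A : Type) : Type := Nine {
  f_r : A; f_t : A; f_ba : A; f_bb : A; f_ti : A;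
  f_lam : A; f_app : A; f_let : A; f_tr : A }.
Arguments Nine {A}.
Arguments f_r {A}. Arguments f_t {A}. Arguments f_ba {A}. Arguments f_bb {A}.
Arguments f_ti {A}. Arguments f_lam {A}. Arguments f_app {A}.
Arguments f_let {A}. Arguments f_tr {A}.

Definition get9 {A} (i : tcon) (v : nine A) : A :=
  match i with
  | c_r => f_r v | c_t => f_t v | c_ba => f_ba v | c_bb => f_bb v
  | c_ti => f_ti v | c_lam => f_lam v | c_app => f_app v
  | c_let => f_let v | c_tr => f_tr v
  end.

Definition set9 {A} (i : tcon) (x : A) (v : nine A) : nine A :=
  let 'Nine a1 a2 a3 a4 a5 a6 a7 a8 a9 := v in
  match i with
  | c_r   => Nine x a2 a3 a4 a5 a6 a7 a8 a9
  | c_t   => Nine a1 x a3 a4 a5 a6 a7 a8 a9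
  | c_ba  => Nine a1 a2 x a4 a5 a6 a7 a8 a9
  | c_bb  => Nine a1 a2 a3 x a5 a6 a7 a8 a9
  | c_ti  => Nine a1 a2 a3 a4 x a6 a7 a8 a9
  | c_lam => Nine a1 a2 a3 a4 a5 x a7 a8 a9
  | c_app => Nine a1 a2 a3 a4 a5 a6 x a8 a9
  | c_let => Nine a1 a2 a3 a4 a5 a6 a7 x a9
  | c_tr  => Nine a1 a2 a3 a4 a5 a6 a7 a8 x
  end.

Definition const9 {A} (x : A) : nine A := Nine x x x x x x x x x.

Definition map9 {A B} (f : A -> B) (v : nine A) : nine B :=
  let 'Nine a1 a2 a3 a4 a5 a6 a7 a8 a9 := v in
  Nine (f a1) (f a2) (f a3) (f a4) (f a5) (f a6) (f a7) (f a8) (f a9).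

Definition map2_9 {A B C} (f : A -> B -> C) (v : nine A) (w : nine B) : nine C :=
  let 'Nine a1 a2 a3 a4 a5 a6 a7 a8 a9 := v in
  let 'Nine b1 b2 b3 b4 b5 b6 b7 b8 b9 := w in
  Nine (f a1 b1) (f a2 b2) (f a3 b3) (f a4 b4) (f a5 b5)
       (f a6 b6) (f a7 b7) (f a8 b8) (f a9 b9).

Definition to_list {A} (v : nine A) : list A :=
  let 'Nine a1 a2 a3 a4 a5 a6 a7 a8 a9 := v in
  [a1; a2; a3; a4; a5; a6; a7; a8; a9].

(** Inverse of [to_list] on lists of length 9, the only ones it is used on;
    the default [d] is then irrelevant. *)
Definition of_list {A} (d : A) (l : list A) : nine A :=
  let a i := nth i l d in
  Nine (a 0) (a 1) (a 2) (a 3) (a 4) (a 5) (a 6) (a 7) (a 8).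

Inductive term : Type :=
| One
| Lam  (M : term)
| App  (M N : term)
| Let  (M N : term)              (* index 1 is bound in [N] *)
| Bang (q : trail) (M : term)    (* !_q M *)
| Aud  (q : trail) (M : term)    (* q |> M *)
| Iota (th : nine term)
| Clos (M : term) (s : subst)    (* M[s] *)
| Er   (M : term)
with trail : Type :=
| tR
| tT (q q' : trail)
| tBa
| tBb
| tTi
| tLam (q : trail)
| tApp (q q' : trail)
| tLet (q q' : trail)
| tTr (z : nine trail)
| Tl (M : term)
with subst : Type :=
| sId                            (* the empty substitution, i.e. the identity *)
| sUp
| sCons (M : term) (s : subst)
| sComp (s t : subst).

Declare Scope cau_scope.
Delimit Scope cau_scope with cau.
Local Open Scope cau_scope.

Notation "q ▷ M" := (Aud q M) (at level 60, right associativity) : cau_scope.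
Notation "M ⟦ s ⟧" := (Clos M s) (at level 2, s at level 60, left associativity,
  format "M ⟦ s ⟧") : cau_scope.
Notation "M · s" := (sCons M s) (at level 55, right associativity) : cau_scope.
Notation "s ∘ t" := (sComp s t) (at level 40, left associativity) : cau_scope.
Notation "q ;; q'" := (tT q q') (at level 50, left associativity) : cau_scope.

(** [up n] is the (n+1)-fold shift, right-nested as in σ-normal forms, and
    [idx n] is the de Bruijn index n+1: all numbering of indices below starts
    at 0. *)
Fixpoint up (n : nat) : subst :=
  match n with 0 => sUp | S n => sUp ∘ up n end.

Definition idx (n : nat) : term :=
  match n with 0 => One | S n => One⟦up n⟧ end.

Definition lift (s : subst) : subst := One · (s ∘ sUp).

(** * The σ- and τ-rules *)

Inductive sigma_tm : term -> term -> Prop :=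
| sg_one_id : sigma_tm (One⟦sId⟧) One
| sg_one_cons M s : sigma_tm (One⟦M · s⟧) M
| sg_lam M s : sigma_tm ((Lam M)⟦s⟧) (Lam (M⟦lift s⟧))
| sg_app M N s : sigma_tm ((App M N)⟦s⟧) (App (M⟦s⟧) (N⟦s⟧))
| sg_bang q M s : sigma_tm ((Bang q M)⟦s⟧) (Bang q (M⟦s⟧))
| sg_let M N s : sigma_tm ((Let M N)⟦s⟧) (Let (M⟦s⟧) (N⟦lift s⟧))
| sg_aud q M s : sigma_tm ((q ▷ M)⟦s⟧) (q ▷ M⟦s⟧)
| sg_iota th s : sigma_tm ((Iota th)⟦s⟧) (Iota (map9 (fun M => M⟦s⟧) th))
| sg_clos M s t : sigma_tm (M⟦s⟧⟦t⟧) (M⟦s ∘ t⟧)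
| sg_er_one : sigma_tm (Er One) One
| sg_er_idx n : sigma_tm (Er (One⟦up n⟧)) (One⟦up n⟧)
| sg_er_lam M : sigma_tm (Er (Lam M)) (Lam (Er M))
| sg_er_app M N : sigma_tm (Er (App M N)) (App (Er M) (Er N))
| sg_er_bang q M : sigma_tm (Er (Bang q M)) (Bang q M)
| sg_er_let M N : sigma_tm (Er (Let M N)) (Let (Er M) (Er N))
| sg_er_aud q M : sigma_tm (Er (q ▷ M)) (Er M)
| sg_er_iota th : sigma_tm (Er (Iota th)) (Iota (map9 Er th)).

Inductive sigma_sb : subst -> subst -> Prop :=
| sg_id_l s : sigma_sb (sId ∘ s) s
| sg_up_id : sigma_sb (sUp ∘ sId) sUp
| sg_up_cons M s : sigma_sb (sUp ∘ (M · s)) s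
| sg_cons_comp M s t : sigma_sb ((M · s) ∘ t) (M⟦t⟧ · (s ∘ t))
| sg_assoc s1 s2 s3 : sigma_sb ((s1 ∘ s2) ∘ s3) (s1 ∘ (s2 ∘ s3)).

Inductive sigma_tr : trail -> trail -> Prop :=
| sg_tl_one : sigma_tr (Tl One) tR
| sg_tl_idx n : sigma_tr (Tl (One⟦up n⟧)) tR
| sg_tl_lam M : sigma_tr (Tl (Lam M)) (tLam (Tl M))
| sg_tl_app M N : sigma_tr (Tl (App M N)) (tApp (Tl M) (Tl N))
| sg_tl_bang q M : sigma_tr (Tl (Bang q M)) tR
| sg_tl_let M N : sigma_tr (Tl (Let M N)) (tLet (Tl M) (Tl N))
| sg_tl_aud q M : sigma_tr (Tl (q ▷ M)) (tT q (Tl M))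
| sg_tl_iota th : sigma_tr (Tl (Iota th)) (tTr (map9 Tl th)).

Inductive tau_tm : term -> term -> Prop :=
| ta_refl M : tau_tm (tR ▷ M) M
| ta_trans q q' M : tau_tm (q ▷ q' ▷ M) (tT q q' ▷ M)
| ta_bang q q' M : tau_tm (Bang q (q' ▷ M)) (Bang (tT q q') M)
| ta_lam q M : tau_tm (Lam (q ▷ M)) (tLam q ▷ Lam M)
| ta_app_l q M N : tau_tm (App (q ▷ M) N) (tApp q tR ▷ App M N)
| ta_app_r q M N : tau_tm (App M (q ▷ N)) (tApp tR q ▷ App M N)
| ta_let_l q M N : tau_tm (Let (q ▷ M) N) (tLet q tR ▷ Let M N)
| ta_let_r q M N : tau_tm (Let M (q ▷ N)) (tLet tR q ▷ Let M N)
| ta_iota i q th :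
    tau_tm (Iota (set9 i (q ▷ get9 i th) th))
           (tTr (set9 i q (const9 tR)) ▷ Iota th).

Inductive tau_tr : trail -> trail -> Prop :=
| ta_t_r q : tau_tr (tT q tR) q
| ta_r_t q : tau_tr (tT tR q) q
| ta_tr_r : tau_tr (tTr (const9 tR)) tR
| ta_app_rr : tau_tr (tApp tR tR) tR
| ta_lam_r : tau_tr (tLam tR) tR
| ta_let_rr : tau_tr (tLet tR tR) tR
| ta_assoc q1 q2 q3 : tau_tr (tT (tT q1 q2) q3) (tT q1 (tT q2 q3))
| ta_lam_lam q q' : tau_tr (tT (tLam q) (tLam q')) (tLam (tT q q'))
| ta_lam_lam_t q1 q1' q :
    tau_tr (tT (tLam q1) (tT (tLam q1') q)) (tT (tLam (tT q1 q1')) q)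
| ta_app_app q1 q2 q1' q2' :
    tau_tr (tT (tApp q1 q2) (tApp q1' q2')) (tApp (tT q1 q1') (tT q2 q2'))
| ta_app_app_t q1 q2 q1' q2' q :
    tau_tr (tT (tApp q1 q2) (tT (tApp q1' q2') q))
           (tT (tApp (tT q1 q1') (tT q2 q2')) q)
| ta_let_let q1 q2 q1' q2' :
    tau_tr (tT (tLet q1 q2) (tLet q1' q2')) (tLet (tT q1 q1') (tT q2 q2'))
| ta_let_let_t q1 q2 q1' q2' q :
    tau_tr (tT (tLet q1 q2) (tT (tLet q1' q2') q))
           (tT (tLet (tT q1 q1') (tT q2 q2')) q)
| ta_tr_tr z z' : tau_tr (tT (tTr z) (tTr z')) (tTr (map2_9 tT z z'))
| ta_tr_tr_t z z' q :
    tau_tr (tT (tTr z) (tT (tTr z') q)) (tT (tTr (map2_9 tT z z')) q).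

(** One στ-step, at any position of a term, trail or substitution. *)
Inductive st_tm : term -> term -> Prop :=
| st_sigma M M' : sigma_tm M M' -> st_tm M M'
| st_tau M M' : tau_tm M M' -> st_tm M M'
| st_lam M M' : st_tm M M' -> st_tm (Lam M) (Lam M')
| st_app_l M M' N : st_tm M M' -> st_tm (App M N) (App M' N)
| st_app_r M N N' : st_tm N N' -> st_tm (App M N) (App M N')
| st_let_l M M' N : st_tm M M' -> st_tm (Let M N) (Let M' N)
| st_let_r M N N' : st_tm N N' -> st_tm (Let M N) (Let M N')
| st_bang_l q q' M : st_tr q q' -> st_tm (Bang q M) (Bang q' M)
| st_bang_r q M M' : st_tm M M' -> st_tm (Bang q M) (Bang q M')
| st_aud_l q q' M : st_tr q q' -> st_tm (q ▷ M) (q' ▷ M)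
| st_aud_r q M M' : st_tm M M' -> st_tm (q ▷ M) (q ▷ M')
| st_iota i th M' : st_tm (get9 i th) M' -> st_tm (Iota th) (Iota (set9 i M' th))
| st_clos_l M M' s : st_tm M M' -> st_tm (M⟦s⟧) (M'⟦s⟧)
| st_clos_r M s s' : st_sb s s' -> st_tm (M⟦s⟧) (M⟦s'⟧)
| st_er M M' : st_tm M M' -> st_tm (Er M) (Er M')
with st_tr : trail -> trail -> Prop :=
| st_sigma_tr q q' : sigma_tr q q' -> st_tr q q'
| st_tau_tr q q' : tau_tr q q' -> st_tr q q'
| st_t_l q1 q1' q2 : st_tr q1 q1' -> st_tr (tT q1 q2) (tT q1' q2)
| st_t_r q1 q2 q2' : st_tr q2 q2' -> st_tr (tT q1 q2) (tT q1 q2')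
| st_tlam q q' : st_tr q q' -> st_tr (tLam q) (tLam q')
| st_tapp_l q1 q1' q2 : st_tr q1 q1' -> st_tr (tApp q1 q2) (tApp q1' q2)
| st_tapp_r q1 q2 q2' : st_tr q2 q2' -> st_tr (tApp q1 q2) (tApp q1 q2')
| st_tlet_l q1 q1' q2 : st_tr q1 q1' -> st_tr (tLet q1 q2) (tLet q1' q2)
| st_tlet_r q1 q2 q2' : st_tr q2 q2' -> st_tr (tLet q1 q2) (tLet q1 q2')
| st_ttr i z q' : st_tr (get9 i z) q' -> st_tr (tTr z) (tTr (set9 i q' z))
| st_tl M M' : st_tm M M' -> st_tr (Tl M) (Tl M')
with st_sb : subst -> subst -> Prop :=
| st_sigma_sb s s' : sigma_sb s s' -> st_sb s s'
| st_cons_l M M' s : st_tm M M' -> st_sb (M · s) (M' · s)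
| st_cons_r M s s' : st_sb s s' -> st_sb (M · s) (M · s')
| st_comp_l s s' t : st_sb s s' -> st_sb (s ∘ t) (s' ∘ t)
| st_comp_r s t t' : st_sb t t' -> st_sb (s ∘ t) (s ∘ t').

Definition st_eq : term -> term -> Prop := clos_refl_sym_trans term st_tm.

(** [q'] is the στ-normal form of the trail [q]. *)
Definition nf_tr (q q' : trail) : Prop :=
  clos_refl_trans trail st_tr q q' /\ forall q'', ~ st_tr q' q''.

(** * Beta-reduction *)

(** [interp th q M] is the graph of the partial map sending [q] to [q theta];
    it is undefined on trails in which [Tl] occurs. *)
Inductive interp (th : nine term) : trail -> term -> Prop :=
| in_r : interp th tR (get9 c_r th)
| in_t q q' M M' : interp th q M -> interp th q' M' ->
    interp th (tT q q') (App (App (get9 c_t th) M) M')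
| in_ba : interp th tBa (get9 c_ba th)
| in_bb : interp th tBb (get9 c_bb th)
| in_ti : interp th tTi (get9 c_ti th)
| in_lam q M : interp th q M -> interp th (tLam q) (App (get9 c_lam th) M)
| in_app q q' M M' : interp th q M -> interp th q' M' ->
    interp th (tApp q q') (App (App (get9 c_app th) M) M')
| in_let q q' M M' : interp th q M -> interp th q' M' ->
    interp th (tLet q q') (App (App (get9 c_let th) M) M')
| in_tr z Ms : (forall i, interp th (get9 i z) (get9 i Ms)) ->
    interp th (tTr z) (fold_left App (to_list Ms) (get9 c_tr th)).

(** Contexts are represented by their (capturing) hole-filling functions, so
    that filling is application; [Fctx], [Ectx] and [Sctx] single out the
    functions generated by the grammars of F, E_σ and S_σ.  In the [iota]
    cases the component of [th] at position [i] is overwritten. *)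
Inductive Fctx : (term -> term) -> Prop :=
| F_hole : Fctx (fun X => X)
| F_lam F : Fctx F -> Fctx (fun X => Lam (F X))
| F_app_l F N : Fctx F -> Fctx (fun X => App (F X) N)
| F_app_r M F : Fctx F -> Fctx (fun X => App M (F X))
| F_let_l F N : Fctx F -> Fctx (fun X => Let (F X) N)
| F_let_r M F : Fctx F -> Fctx (fun X => Let M (F X))
| F_aud q F : Fctx F -> Fctx (fun X => q ▷ F X)
| F_iota i th F : Fctx F -> Fctx (fun X => Iota (set9 i (F X) th))
| F_clos F s : Fctx F -> Fctx (fun X => (F X)⟦s⟧).

Inductive Ectx : (term -> term) -> Prop :=
| E_hole : Ectx (fun X => X)
| E_lam E : Ectx E -> Ectx (fun X => Lam (E X))
| E_app_l E N : Ectx E -> Ectx (fun X => App (E X) N)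
| E_app_r M E : Ectx E -> Ectx (fun X => App M (E X))
| E_let_l E N : Ectx E -> Ectx (fun X => Let (E X) N)
| E_let_r M E : Ectx E -> Ectx (fun X => Let M (E X))
| E_bang q E : Ectx E -> Ectx (fun X => Bang q (E X))
| E_aud q E : Ectx E -> Ectx (fun X => q ▷ E X)
| E_iota i th E : Ectx E -> Ectx (fun X => Iota (set9 i (E X) th))
| E_clos_l E s : Ectx E -> Ectx (fun X => (E X)⟦s⟧)
| E_clos_r M S : Sctx S -> Ectx (fun X => M⟦S X⟧)
with Sctx : (term -> subst) -> Prop :=
| S_comp_l S t : Sctx S -> Sctx (fun X => S X ∘ t)
| S_comp_r s S : Sctx S -> Sctx (fun X => s ∘ S X)
| S_cons_l E s : Ectx E -> Sctx (fun X => E X · s)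
| S_cons_r M S : Sctx S -> Sctx (fun X => M · S X).

Inductive beta_rule : term -> term -> Prop :=
| beta_lam M N :
    beta_rule (App (Lam M) N)
      (tT (tApp (tLam (Tl M)) (Tl N)) tBa ▷ (Er M)⟦Er N · sId⟧)
| beta_let q M N :
    beta_rule (Let (Bang q M) N)
      (tT (tLet tR (Tl N)) tBb ▷ (Er N)⟦(q ▷ M) · sId⟧)
| beta_ti q F th q' M :
    Fctx F -> nf_tr (tT q (Tl (F (Iota th)))) q' -> interp th q' M ->
    beta_rule (Bang q (F (Iota th))) (Bang q (F (tTi ▷ M))).

Inductive beta : term -> term -> Prop :=
| beta_ctx E M N : Ectx E -> beta_rule M N -> beta (E M) (E N).

Definition cau (M N : term) : Prop := beta M N \/ st_eq M N.

Definition cau_star : term -> term -> Prop := clos_refl_trans term cau.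

(** * The abstract machine *)

Inductive tl_free : trail -> Prop :=
| tf_r : tl_free tR
| tf_t q q' : tl_free q -> tl_free q' -> tl_free (tT q q')
| tf_ba : tl_free tBa
| tf_bb : tl_free tBb
| tf_ti : tl_free tTi
| tf_lam q : tl_free q -> tl_free (tLam q)
| tf_app q q' : tl_free q -> tl_free q' -> tl_free (tApp q q')
| tf_let q q' : tl_free q -> tl_free q' -> tl_free (tLet q q')
| tf_tr z : (forall i, tl_free (get9 i z)) -> tl_free (tTr z).

Inductive pure : term -> Prop :=
| pu_idx n : pure (idx n)
| pu_lam M : pure M -> pure (Lam M)
| pu_app M N : pure M -> pure N -> pure (App M N)
| pu_let M N : pure M -> pure N -> pure (Let M N)
| pu_bang q M : tl_free q -> pure M -> pure (Bang q M)
| pu_aud q M : pure M -> pure (q ▷ M)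
| pu_iota th : (forall i, pure (get9 i th)) -> pure (Iota th).

Inductive closure : term -> Prop :=
| cl_lam M e : pure M -> env e -> closure (Er ((Lam M)⟦e⟧))
| cl_bang q C : closure C -> closure (Bang q C)
with value : term -> Prop :=
| va_clos q C : closure C -> value (q ▷ C)
| va_bang q V : value V -> value (q ▷ Bang tR V)
with env : subst -> Prop :=
| en_nil : env sId
| en_cons V e : value V -> env e -> env (V · e).

(** [free k M]: index k+1 is free in [M].  Substitutions do not act on trails,
    hence trails contribute no free indices.
    [free_sub k i s]: index k+1 is free in the term that [s] assigns to index
    i+1. *)
Inductive free : nat -> term -> Prop :=
| fr_one : free 0 One
| fr_lam k M : free (S k) M -> free k (Lam M)
| fr_app_l k M N : free k M -> free k (App M N)
| fr_app_r k M N : free k N -> free k (App M N)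
| fr_let_l k M N : free k M -> free k (Let M N)
| fr_let_r k M N : free (S k) N -> free k (Let M N)
| fr_bang k q M : free k M -> free k (Bang q M)
| fr_aud k q M : free k M -> free k (q ▷ M)
| fr_iota k i th : free k (get9 i th) -> free k (Iota th)
| fr_clos k i M s : free i M -> free_sub k i s -> free k (M⟦s⟧)
| fr_er k M : free k M -> free k (Er M)
with free_sub : nat -> nat -> subst -> Prop :=
| fs_id k : free_sub k k sId
| fs_up k : free_sub (S k) k sUp
| fs_cons_0 k M s : free k M -> free_sub k 0 (M · s)
| fs_cons_S k i M s : free_sub k i s -> free_sub k (S i) (M · s)
| fs_comp k j i s t : free_sub j i s -> free_sub k j t -> free_sub k i (s ∘ t).

Definition closed (M : term) : Prop := forall k, ~ free k M.

Fixpoint entries (e : subst) : list term :=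
  match e with V · e' => V :: entries e' | _ => [] end.

Inductive code : Type :=
| KTerm (M : term)
| KApp
| KBang
| KLet (M : term)
| KIota.

Inductive tuple : Type := Tup (q : trail) (k : code) (e : subst).

Definition stack : Type := list tuple.
Definition dump : Type := list term.
Definition config : Type := (stack * dump)%type.

Definition tuple_sorted (x : tuple) : Prop :=
  let 'Tup _ k e := x in
  env e /\ match k with KTerm M | KLet M => pure M | _ => True end.

(** Codes carry pure terms, environments and dumps carry values. *)
Definition sorted (c : config) : Prop :=
  Forall tuple_sorted (fst c) /\ Forall value (snd c).

(** The tuples (q_(k+1) | M_(k+1) | e_(k+1)) :: ... :: (q_9 | M_9 | e_9). *)
Definition run : Type := list (trail * term * subst).
Definition run_tuples (r : run) : stack :=
  map (fun '(q, M, e) => Tup q (KTerm M) e) r.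
Definition run_terms (r : run) : list term :=
  map (fun '(q, M, e) => q ▷ Er (M⟦e⟧)) r.
Definition run_trails (r : run) : list trail :=
  map (fun '(q, _, _) => q) r.

(** The values V_1, ..., V_n already computed for an [iota] are pushed on the
    dump one after the other, so the dump is V_n :: ... :: V_1 :: D, that is
    [rev Vs ++ D] (just as V is pushed before W in the case of application). *)
Inductive wf_ctx : stack -> dump -> Prop :=
| wc_nil : wf_ctx [] []
| wc_app_l q M e q' π D : wf_ctx π D ->
    wf_ctx (Tup q (KTerm M) e :: Tup q' KApp sId :: π) D
| wc_app_r q π V D : wf_ctx π D ->
    wf_ctx (Tup q KApp sId :: π) (V :: D)
| wc_let q M e π D : wf_ctx π D ->
    wf_ctx (Tup q (KLet M) e :: π) D
| wc_bang q π D : wf_ctx π D ->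
    wf_ctx (Tup q KBang sId :: π) D
| wc_iota (r : run) q' π (Vs : list term) D :
    length Vs + 1 + length r = 9 -> wf_ctx π D ->
    wf_ctx (run_tuples r ++ Tup q' KIota sId :: π) (rev Vs ++ D).

Inductive wf_tm : config -> Prop :=
| wt_val V : wf_tm ([], [V])
| wt_term q M e π D : wf_ctx π D -> wf_tm (Tup q (KTerm M) e :: π, D)
| wt_app q π W V D : wf_ctx π D -> wf_tm (Tup q KApp sId :: π, W :: V :: D)
| wt_let q M e π V D : wf_ctx π D -> wf_tm (Tup q (KLet M) e :: π, V :: D)
| wt_bang q π V D : wf_ctx π D -> wf_tm (Tup q KBang sId :: π, V :: D)
| wt_iota q π (Vs : nine term) D : wf_ctx π D ->
    wf_tm (Tup q KIota sId :: π, rev (to_list Vs) ++ D).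

(** Denotations, as graphs of the partial maps on configurations; see
    [den_tm_fun] and [wf_tm_den] below. *)
Inductive den_ctx : stack -> dump -> (term -> term) -> Prop :=
| dc_nil : den_ctx [] [] (fun X => X)
| dc_app_l q M e q' π D C : den_ctx π D C ->
    den_ctx (Tup q (KTerm M) e :: Tup q' KApp sId :: π) D
      (fun X => C (q' ▷ App X (q ▷ Er (M⟦e⟧))))
| dc_app_r q π V D C : den_ctx π D C ->
    den_ctx (Tup q KApp sId :: π) (V :: D) (fun X => C (q ▷ App V X))
| dc_let q M e π D C : den_ctx π D C ->
    den_ctx (Tup q (KLet M) e :: π) D
      (fun X => C (q ▷ Let X (Er (M⟦lift e⟧))))
| dc_bang q π D C : den_ctx π D C ->
    den_ctx (Tup q KBang sId :: π) D (fun X => C (q ▷ Bang tR X))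
| dc_iota (r : run) q' π (Vs : list term) D C :
    length Vs + 1 + length r = 9 -> den_ctx π D C ->
    den_ctx (run_tuples r ++ Tup q' KIota sId :: π) (rev Vs ++ D)
      (fun X => C (q' ▷ Iota (of_list One (Vs ++ X :: run_terms r)))).

Inductive den_tm : config -> term -> Prop :=
| dt_val V : den_tm ([], [V]) V
| dt_term q M e π D C : den_ctx π D C ->
    den_tm (Tup q (KTerm M) e :: π, D) (C (q ▷ Er (M⟦e⟧)))
| dt_app q π W V D C : den_ctx π D C ->
    den_tm (Tup q KApp sId :: π, W :: V :: D) (C (q ▷ App V W))
| dt_let q M e π V D C : den_ctx π D C ->
    den_tm (Tup q (KLet M) e :: π, V :: D)
      (C (q ▷ Let V (Er (M⟦lift e⟧))))
| dt_bang q π V D C : den_ctx π D C ->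
    den_tm (Tup q KBang sId :: π, V :: D) (C (q ▷ Bang tR V))
| dt_iota q π (Vs : nine term) D C : den_ctx π D C ->
    den_tm (Tup q KIota sId :: π, rev (to_list Vs) ++ D) (C (q ▷ Iota Vs)).

Definition valid (c : config) : Prop :=
  sorted c /\ wf_tm c /\
  (forall q M e, In (Tup q (KTerm M) e) (fst c) ->
     closed (M⟦e⟧) /\ Forall closed (entries e)) /\
  Forall closed (snd c).

(** [lookup e n] is e(n+1). *)
Fixpoint lookup (e : subst) (n : nat) : option term :=
  match e, n with
  | (_ ▷ C) · _, 0 => Some C
  | _ · e', S m => lookup e' m
  | _, _ => None
  end.

(** Trail materialization, as the graph of a partial map. *)
Inductive materialize : trail -> stack -> dump -> trail -> Prop :=
| ma_bang p q q' π D : nf_tr p q ->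
    materialize p (Tup q' KBang sId :: π) D q
| ma_app_l p q q' M e q'' π D :
    materialize (q'' ;; tApp p q') π D q ->
    materialize p (Tup q' (KTerm M) e :: Tup q'' KApp sId :: π) D q
| ma_app_r p q q' q'' C π D :
    materialize (q' ;; tApp q'' p) π D q ->
    materialize p (Tup q' KApp sId :: π) ((q'' ▷ C) :: D) q
| ma_let p q q' M e π D :
    materialize (q' ;; tLet p tR) π D q ->
    materialize p (Tup q' (KLet M) e :: π) D q
| ma_iota p q (r : run) q' π (qCs : list (trail * term)) D :
    length qCs + 1 + length r = 9 ->
    materialize (q' ;; tTr (of_list tR (map fst qCs ++ p :: run_trails r))) π D q ->
    materialize p (run_tuples r ++ Tup q' KIota sId :: π)
      (rev (map (fun '(q, C) => q ▷ C) qCs) ++ D) q.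

(** The encoding of a trail as a pure term: the i-th constructor is read as
    the index i, constructor application as term application. *)
Definition encode (q : trail) (M : term) : Prop :=
  interp (Nine (idx 0) (idx 1) (idx 2) (idx 3) (idx 4)
               (idx 5) (idx 6) (idx 7) (idx 8)) q M.

Inductive step : config -> config -> Prop :=
| step_app q M N e π D :
    step (Tup q (KTerm (App M N)) e :: π, D)
         (Tup tR (KTerm M) e :: Tup tR (KTerm N) e :: Tup q KApp sId :: π, D)
| step_beta q q' C q'' M e π D :
    step (Tup q KApp sId :: π, (q' ▷ C) :: (q'' ▷ Er ((Lam M)⟦e⟧)) :: D)
         (Tup (q ;; tApp q'' q' ;; tBa) (KTerm M) ((tR ▷ C) · e) :: π, D)
| step_lam q M e π D :
    step (Tup q (KTerm (Lam M)) e :: π, D)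
         (π, (q ▷ Er ((Lam M)⟦e⟧)) :: D)
| step_let q M N e π D :
    step (Tup q (KTerm (Let M N)) e :: π, D)
         (Tup tR (KTerm M) e :: Tup q (KLet N) e :: π, D)
| step_let_bang q q' N e V π D :
    value V ->
    step (Tup q (KLet N) e :: π, (q' ▷ Bang tR V) :: D)
         (Tup (q ;; tLet q' tR ;; tBb ;; Tl ((Er (N⟦lift e⟧))⟦V · sId⟧))
              (KTerm N) (V · e) :: π, D)
| step_bang q q' M e π D :
    step (Tup q (KTerm (Bang q' M)) e :: π, D)
         (Tup (q' ;; Tl (M⟦e⟧)) (KTerm M) e :: Tup q KBang sId :: π, D)
| step_bang_val q V π D :
    step (Tup q KBang sId :: π, V :: D)
         (π, (q ▷ Bang tR V) :: D)
| step_iota q th e π D :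
    step (Tup q (KTerm (Iota th)) e :: π, D)
         (map (fun M => Tup tR (KTerm M) e) (to_list th)
            ++ Tup q KIota sId :: π, D)
| step_ti q (qs : nine trail) (Cs : nine term) π D q' M :
    materialize (q ;; tTr qs) π D q' ->
    encode q' M ->
    step (Tup q KIota sId :: π, rev (to_list (map2_9 Aud qs Cs)) ++ D)
         (Tup (q ;; tTr qs ;; tTi) (KTerm M)
              (fold_right (fun C e => (tR ▷ C) · e) sId (to_list Cs)) :: π, D)
| step_idx q n e C π D :
    lookup e n = Some C ->
    step (Tup q (KTerm (idx n)) e :: π, D)
         (π, (q ▷ C) :: D).

(** * The denotation is a function, defined on all well-formed configurations *)

Lemma run_tuples_inj (r r' : run) q q' π π' :
  run_tuples r ++ Tup q KIota sId :: π = run_tuples r' ++ Tup q' KIota sId :: π' ->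
  r = r' /\ q = q' /\ π = π'.
Proof.
revert r'; induction r as [|[[p M] e] r IH]; intros [|[[p' M'] e'] r']; simpl;
  intros H; try discriminate.
- now injection H.
- injection H as -> -> -> H; destruct (IH _ H) as (-> & -> & ->); auto.
Qed.

Lemma rev_app_inj {A} (l l' m m' : list A) :
  length l = length l' -> rev l ++ m = rev l' ++ m' -> l = l' /\ m = m'.
Proof.
revert l' m m'; induction l as [|x l IH]; intros [|y l'] m m' Hl H;
  try discriminate; auto.
simpl in H; rewrite <- !app_assoc in H.
destruct (IH l' _ _ (eq_add_S _ _ Hl) H) as [-> E]; now injection E as -> ->.
Qed.

Lemma to_list_inj {A} (v w : nine A) : to_list v = to_list w -> v = w.
Proof. destruct v, w; simpl; congruence. Qed.

Lemma den_ctx_fun π D C C' : den_ctx π D C -> den_ctx π D C' -> C = C'.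
Proof.
intros H; revert C'; induction H; intros C' H'; inversion H'; subst;
  try (match goal with
       | E : run_tuples ?r ++ _ = _ |- _ =>
           destruct r as [|[[? ?] ?] [|[[? ?] ?] ?]]; discriminate
       | E : _ = run_tuples ?r ++ _ |- _ =>
           destruct r as [|[[? ?] ?] [|[[? ?] ?] ?]]; discriminate
       end);
  try (match goal with
       | E : run_tuples _ ++ _ = run_tuples _ ++ _ |- _ =>
           apply run_tuples_inj in E; destruct E as (-> & -> & ->)
       end;
       match goal with
       | E : rev _ ++ _ = rev _ ++ _ |- _ =>
           apply rev_app_inj in E; [destruct E as (-> & ->) | lia]
       end);
  try reflexivity;
  match goal with
  | IH : forall C', den_ctx ?π ?D C' -> _, G : den_ctx ?π ?D _ |- _ =>
      now rewrite (IH _ G)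
  end.
Qed.

Lemma den_tm_fun c M M' : den_tm c M -> den_tm c M' -> M = M'.
Proof.
intros H H'; destruct H; inversion H'; subst;
  try (match goal with
       | H1 : den_ctx ?π ?D _, H2 : den_ctx ?π ?D _ |- _ =>
           now rewrite (den_ctx_fun _ _ _ _ H1 H2)
       end); auto.
match goal with E : rev _ ++ _ = _ |- _ =>
  apply rev_app_inj in E; [destruct E as (E & ->) | now destruct Vs, Vs0] end.
match goal with E : to_list _ = _ |- _ => apply to_list_inj in E; subst end.
match goal with H1 : den_ctx ?π ?D _, H2 : den_ctx ?π ?D _ |- _ =>
  now rewrite (den_ctx_fun _ _ _ _ H1 H2) end.
Qed.

Lemma wf_ctx_den π D : wf_ctx π D -> exists C, den_ctx π D C.
Proof.
induction 1; try destruct IHwf_ctx as [C HC]; eexists; econstructor; eassumption.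
Qed.

Lemma wf_tm_den c : wf_tm c -> exists M, den_tm c M.
Proof.
intros []; try (match goal with H : wf_ctx _ _ |- _ =>
  destruct (wf_ctx_den _ _ H) as [C HC] end); eexists; econstructor; eassumption.
Qed.

(* Main.v *)
(** Every term is στ-convertible to one without explicit substitutions and
    erasures, [Er] sends every term to one whose trail is convertible to [tR],
    and [M ≡ Tl M ▷ Er M].  Hence all machine steps except beta, let-bang and
    trail inspection are στ-conversions of denotations, and in the first two
    the subterms of the redex contribute no trail.  For trail inspection, the
    material surrounding the redex up to the nearest bang is first replaced by
    substitution- and erasure-free terms; after that the trail of the context
    reduces, with no need for confluence, to the trail accumulated by
    materialization. *)

From Stdlib Require Import List Relations Arith Lia Setoid Morphisms.
Require Import Defs.
Import ListNotations.
Local Open Scope cau_scope.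

Definition tr_eq : trail -> trail -> Prop := clos_refl_sym_trans trail st_tr.
Definition sb_eq : subst -> subst -> Prop := clos_refl_sym_trans subst st_sb.
(** The side condition [nf_tr] of trail inspection asks for a directed reduction to a normal form,
    so for trails reduction is tracked besides conversion. *)
Definition tr_red : trail -> trail -> Prop := clos_refl_trans trail st_tr.

Local Notation "M ≡ N" := (st_eq M N) (at level 70).
Local Notation "q ≡t q'" := (tr_eq q q') (at level 70).
Local Notation "s ≡s t" := (sb_eq s t) (at level 70).
Local Notation "q ↠ q'" := (tr_red q q') (at level 70).

(** * Congruence *)

Lemma clos_rst_map A B (R : relation A) (S : relation B) (f : A -> B) :
  (forall x y, R x y -> S (f x) (f y)) ->
  Proper (clos_refl_sym_trans A R ==> clos_refl_sym_trans B S) f.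
Proof.
intros Hf x y H; induction H.
- now apply rst_step, Hf.
- apply rst_refl.
- now apply rst_sym.
- eapply rst_trans; eassumption.
Qed.

Lemma clos_rt_map A B (R : relation A) (S : relation B) (f : A -> B) :
  (forall x y, R x y -> S (f x) (f y)) ->
  Proper (clos_refl_trans A R ==> clos_refl_trans B S) f.
Proof.
intros Hf x y H; induction H.
- now apply rt_step, Hf.
- apply rt_refl.
- eapply rt_trans; eassumption.
Qed.

#[local] Instance clos_rst_Equivalence A (R : relation A) :
  Equivalence (clos_refl_sym_trans A R).
Proof.
split; red; [apply rst_refl | intros; now apply rst_sym | intros; eapply rst_trans; eassumption].
Qed.

#[local] Instance st_eq_Equivalence : Equivalence st_eq := clos_rst_Equivalence _ _.
#[local] Instance tr_eq_Equivalence : Equivalence tr_eq := clos_rst_Equivalence _ _.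
#[local] Instance sb_eq_Equivalence : Equivalence sb_eq := clos_rst_Equivalence _ _.
#[local] Instance tr_red_PreOrder : PreOrder tr_red.
Proof. split; red; [apply rt_refl | intros; eapply rt_trans; eassumption]. Qed.

Lemma Proper2 {A B C} (RA : relation A) (RB : relation B) (RC : relation C)
    `{Transitive C RC} (f : A -> B -> C) :
  (forall b, Proper (RA ==> RC) (fun a => f a b)) ->
  (forall a, Proper (RB ==> RC) (f a)) ->
  Proper (RA ==> RB ==> RC) f.
Proof.
intros Hl Hr a a' Ha b b' Hb.
transitivity (f a' b); [exact (Hl b a a' Ha) | exact (Hr a' b b' Hb)].
Qed.

Local Ltac congr c1 c2 :=
  apply (Proper2 _ _ _); intro; (apply clos_rst_map || apply clos_rt_map);
  intros; solve [now apply c1 | now apply c2].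

#[local] Instance Lam_eq : Proper (st_eq ==> st_eq) Lam.
Proof. apply clos_rst_map; exact st_lam. Qed.
#[local] Instance App_eq : Proper (st_eq ==> st_eq ==> st_eq) App.
Proof. congr st_app_l st_app_r. Qed.
#[local] Instance Let_eq : Proper (st_eq ==> st_eq ==> st_eq) Let.
Proof. congr st_let_l st_let_r. Qed.
#[local] Instance Bang_eq : Proper (tr_eq ==> st_eq ==> st_eq) Bang.
Proof. congr st_bang_l st_bang_r. Qed.
#[local] Instance Aud_eq : Proper (tr_eq ==> st_eq ==> st_eq) Aud.
Proof. congr st_aud_l st_aud_r. Qed.
#[local] Instance Clos_eq : Proper (st_eq ==> sb_eq ==> st_eq) Clos.
Proof. congr st_clos_l st_clos_r. Qed.
#[local] Instance Er_eq : Proper (st_eq ==> st_eq) Er.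
Proof. apply clos_rst_map; exact st_er. Qed.
#[local] Instance Tl_eq : Proper (st_eq ==> tr_eq) Tl.
Proof. apply clos_rst_map; exact st_tl. Qed.
#[local] Instance tT_eq : Proper (tr_eq ==> tr_eq ==> tr_eq) tT.
Proof. congr st_t_l st_t_r. Qed.
#[local] Instance tLam_eq : Proper (tr_eq ==> tr_eq) tLam.
Proof. apply clos_rst_map; exact st_tlam. Qed.
#[local] Instance tApp_eq : Proper (tr_eq ==> tr_eq ==> tr_eq) tApp.
Proof. congr st_tapp_l st_tapp_r. Qed.
#[local] Instance tLet_eq : Proper (tr_eq ==> tr_eq ==> tr_eq) tLet.
Proof. congr st_tlet_l st_tlet_r. Qed.
#[local] Instance sCons_eq : Proper (st_eq ==> sb_eq ==> sb_eq) sCons.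
Proof. congr st_cons_l st_cons_r. Qed.
#[local] Instance sComp_eq : Proper (sb_eq ==> sb_eq ==> sb_eq) sComp.
Proof. congr st_comp_l st_comp_r. Qed.
#[local] Instance tT_red : Proper (tr_red ==> tr_red ==> tr_red) tT.
Proof. congr st_t_l st_t_r. Qed.
#[local] Instance tLam_red : Proper (tr_red ==> tr_red) tLam.
Proof. apply clos_rt_map; exact st_tlam. Qed.
#[local] Instance tApp_red : Proper (tr_red ==> tr_red ==> tr_red) tApp.
Proof. congr st_tapp_l st_tapp_r. Qed.
#[local] Instance tLet_red : Proper (tr_red ==> tr_red ==> tr_red) tLet.
Proof. congr st_tlet_l st_tlet_r. Qed.

(** * Families of nine components *)

Lemma get9_set9 {A} i (x : A) v : get9 i (set9 i x v) = x.
Proof. now destruct i, v. Qed.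

Lemma set9_set9 {A} i (x y : A) v : set9 i y (set9 i x v) = set9 i y v.
Proof. now destruct i, v. Qed.

Lemma get9_map9 {A B} (f : A -> B) i v : get9 i (map9 f v) = f (get9 i v).
Proof. now destruct i, v. Qed.

Lemma get9_map2_9 {A B C} (f : A -> B -> C) i v w :
  get9 i (map2_9 f v w) = f (get9 i v) (get9 i w).
Proof. now destruct i, v, w. Qed.

Lemma get9_const9 {A} (x : A) i : get9 i (const9 x) = x.
Proof. now destruct i. Qed.

Lemma nine_choice {A} (P : tcon -> A -> Prop) :
  (forall i, exists x, P i x) -> exists v, forall i, P i (get9 i v).
Proof.
intros H.
destruct (H c_r) as [a1 H1], (H c_t) as [a2 H2], (H c_ba) as [a3 H3],
  (H c_bb) as [a4 H4], (H c_ti) as [a5 H5], (H c_lam) as [a6 H6],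
  (H c_app) as [a7 H7], (H c_let) as [a8 H8], (H c_tr) as [a9 H9].
now exists (Nine a1 a2 a3 a4 a5 a6 a7 a8 a9); intros [].
Qed.

(** One component is exchanged at a time: the intermediate families agree with [w] on an initial
    segment and with [v] on the rest. *)
Lemma nine_pointwise {A B} (R : relation A) (S : relation B) `{PreOrder B S}
    (f : nine A -> B) :
  (forall i v x y, R x y -> S (f (set9 i x v)) (f (set9 i y v))) ->
  forall v w, (forall i, R (get9 i v) (get9 i w)) -> S (f v) (f w).
Proof.
intros Hf [a1 a2 a3 a4 a5 a6 a7 a8 a9] [b1 b2 b3 b4 b5 b6 b7 b8 b9] E.
transitivity (f (Nine b1 a2 a3 a4 a5 a6 a7 a8 a9)).
{ exact (Hf c_r (Nine a1 a2 a3 a4 a5 a6 a7 a8 a9) _ _ (E c_r)). }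
transitivity (f (Nine b1 b2 a3 a4 a5 a6 a7 a8 a9)).
{ exact (Hf c_t (Nine b1 a2 a3 a4 a5 a6 a7 a8 a9) _ _ (E c_t)). }
transitivity (f (Nine b1 b2 b3 a4 a5 a6 a7 a8 a9)).
{ exact (Hf c_ba (Nine b1 b2 a3 a4 a5 a6 a7 a8 a9) _ _ (E c_ba)). }
transitivity (f (Nine b1 b2 b3 b4 a5 a6 a7 a8 a9)).
{ exact (Hf c_bb (Nine b1 b2 b3 a4 a5 a6 a7 a8 a9) _ _ (E c_bb)). }
transitivity (f (Nine b1 b2 b3 b4 b5 a6 a7 a8 a9)).
{ exact (Hf c_ti (Nine b1 b2 b3 b4 a5 a6 a7 a8 a9) _ _ (E c_ti)). }
transitivity (f (Nine b1 b2 b3 b4 b5 b6 a7 a8 a9)).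
{ exact (Hf c_lam (Nine b1 b2 b3 b4 b5 a6 a7 a8 a9) _ _ (E c_lam)). }
transitivity (f (Nine b1 b2 b3 b4 b5 b6 b7 a8 a9)).
{ exact (Hf c_app (Nine b1 b2 b3 b4 b5 b6 a7 a8 a9) _ _ (E c_app)). }
transitivity (f (Nine b1 b2 b3 b4 b5 b6 b7 b8 a9)).
{ exact (Hf c_let (Nine b1 b2 b3 b4 b5 b6 b7 a8 a9) _ _ (E c_let)). }
exact (Hf c_tr (Nine b1 b2 b3 b4 b5 b6 b7 b8 a9) _ _ (E c_tr)).
Qed.

Lemma Iota_eq th th' :
  (forall i, get9 i th ≡ get9 i th') -> Iota th ≡ Iota th'.
Proof.
apply (nine_pointwise st_eq st_eq Iota); intros i v.
apply (clos_rst_map _ _ _ _ (fun x => Iota (set9 i x v))); intros x y H.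
rewrite <- (set9_set9 i x y); apply st_iota; now rewrite get9_set9.
Qed.

Lemma tTr_step i v x y : st_tr x y -> st_tr (tTr (set9 i x v)) (tTr (set9 i y v)).
Proof.
intros H; rewrite <- (set9_set9 i x y); apply st_ttr; now rewrite get9_set9.
Qed.

Lemma tTr_eq z z' : (forall i, get9 i z ≡t get9 i z') -> tTr z ≡t tTr z'.
Proof.
apply (nine_pointwise tr_eq tr_eq tTr); intros i v.
apply (clos_rst_map _ _ _ _ (fun x => tTr (set9 i x v))), tTr_step.
Qed.

Lemma tTr_red z z' : (forall i, get9 i z ↠ get9 i z') -> tTr z ↠ tTr z'.
Proof.
apply (nine_pointwise tr_red tr_red tTr); intros i v.
apply (clos_rt_map _ _ _ _ (fun x => tTr (set9 i x v))), tTr_step.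
Qed.

(** * The rules as conversions and reductions *)

Lemma sigma_eq M N : sigma_tm M N -> M ≡ N.
Proof. intros; now apply rst_step, st_sigma. Qed.
Lemma tau_eq M N : tau_tm M N -> M ≡ N.
Proof. intros; now apply rst_step, st_tau. Qed.
Lemma sigma_sb_eq s t : sigma_sb s t -> s ≡s t.
Proof. intros; now apply rst_step, st_sigma_sb. Qed.
Lemma sigma_tr_eq q q' : sigma_tr q q' -> q ≡t q'.
Proof. intros; now apply rst_step, st_sigma_tr. Qed.
Lemma tau_tr_eq q q' : tau_tr q q' -> q ≡t q'.
Proof. intros; now apply rst_step, st_tau_tr. Qed.
Lemma sigma_tr_red q q' : sigma_tr q q' -> q ↠ q'.
Proof. intros; now apply rt_step, st_sigma_tr. Qed.
Lemma tau_tr_red q q' : tau_tr q q' -> q ↠ q'.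
Proof. intros; now apply rt_step, st_tau_tr. Qed.

Lemma tr_red_eq q q' : q ↠ q' -> q ≡t q'.
Proof. apply clos_rt_clos_rst. Qed.

(** * Explicit substitutions on indices *)

Lemma up_sUp n : up n ∘ sUp ≡s up (S n).
Proof.
induction n as [|n IH]; simpl; [reflexivity|].
rewrite (sigma_sb_eq _ _ (sg_assoc _ _ _)), IH; reflexivity.
Qed.

Lemma idx_sUp n : (idx n)⟦sUp⟧ ≡ idx (S n).
Proof.
destruct n as [|n]; [reflexivity|].
simpl idx; rewrite (sigma_eq _ _ (sg_clos _ _ _)), up_sUp; reflexivity.
Qed.

Lemma up_cons n M t : up (S n) ∘ (M · t) ≡s up n ∘ t.
Proof.
induction n as [|n IH].
- simpl; now rewrite (sigma_sb_eq _ _ (sg_assoc _ _ _)), (sigma_sb_eq _ _ (sg_up_cons _ _)).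
- change (up (S (S n))) with (sUp ∘ up (S n)).
  rewrite (sigma_sb_eq _ _ (sg_assoc _ _ _)), IH; simpl.
  symmetry; apply sigma_sb_eq, sg_assoc.
Qed.

Lemma idx_cons n M t : (idx (S n))⟦M · t⟧ ≡ (idx n)⟦t⟧.
Proof.
destruct n as [|n]; simpl idx; rewrite (sigma_eq _ _ (sg_clos _ _ _)).
- simpl; now rewrite (sigma_sb_eq _ _ (sg_up_cons _ _)).
- change (sUp ∘ up n) with (up (S n)); rewrite up_cons.
  symmetry; apply sigma_eq, sg_clos.
Qed.

Lemma idx_lift_S n s : (idx (S n))⟦lift s⟧ ≡ (idx n)⟦s⟧⟦sUp⟧.
Proof.
unfold lift; rewrite idx_cons; symmetry; apply sigma_eq, sg_clos.
Qed.

Lemma up_sId n : up n ∘ sId ≡s up n.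
Proof.
induction n as [|n IH]; simpl; [apply sigma_sb_eq, sg_up_id|].
now rewrite (sigma_sb_eq _ _ (sg_assoc _ _ _)), IH.
Qed.

Lemma idx_sId n : (idx n)⟦sId⟧ ≡ idx n.
Proof.
destruct n as [|n]; simpl; [apply sigma_eq, sg_one_id|].
now rewrite (sigma_eq _ _ (sg_clos _ _ _)), up_sId.
Qed.

(** The substitution law behind the two machine steps that extend an environment: the shift inside
    [lift] cancels against the new entry. No σ-rule makes [sId] neutral on the right in general, so
    this is assumed of [s]; [env_id] supplies it for environments. *)
Lemma lift_cons s M : s ∘ sId ≡s s -> lift s ∘ (M · sId) ≡s M · s.
Proof.
intros H; unfold lift.
rewrite (sigma_sb_eq _ _ (sg_cons_comp _ _ _)), (sigma_eq _ _ (sg_one_cons _ _)),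
  (sigma_sb_eq _ _ (sg_assoc _ _ _)), (sigma_sb_eq _ _ (sg_up_cons _ _)), H.
reflexivity.
Qed.

Lemma clos_iota th s : (Iota th)⟦s⟧ ≡ Iota (map9 (fun M => M⟦s⟧) th).
Proof. apply sigma_eq, sg_iota. Qed.

(** * Terms without explicit substitution and erasure *)

(** With [b = false], audited terms may occur only under a bang: these are the
    results of [Er]. *)
Inductive nform (b : bool) : term -> Prop :=
| nf_idx n : nform b (idx n)
| nf_lam M : nform b M -> nform b (Lam M)
| nf_app M N : nform b M -> nform b N -> nform b (App M N)
| nf_let M N : nform b M -> nform b N -> nform b (Let M N)
| nf_bang q M : nform true M -> nform b (Bang q M)
| nf_aud q M : b = true -> nform b M -> nform b (q ▷ M)
| nf_iota th : (forall i, nform b (get9 i th)) -> nform b (Iota th).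

Definition has_nf (b : bool) (M : term) : Prop := exists N, nform b N /\ M ≡ N.

#[local] Instance has_nf_eq b : Proper (st_eq ==> iff) (has_nf b).
Proof.
intros M N E; split; intros (P & HP & H); exists P; split; trivial.
- now rewrite <- E.
- now rewrite E.
Qed.

Lemma nform_has_nf b M : nform b M -> has_nf b M.
Proof. now exists M. Qed.

Lemma nform_weaken b M : nform b M -> nform true M.
Proof. induction 1; constructor; auto. Qed.

Lemma has_nf_weaken b M : has_nf b M -> has_nf true M.
Proof. intros (N & HN & E); exists N; split; [now apply (nform_weaken b) | trivial]. Qed.

Lemma has_nf_lam b M : has_nf b M -> has_nf b (Lam M).
Proof. intros (N & HN & E); exists (Lam N); split; [now constructor | now rewrite E]. Qed.

Lemma has_nf_app b M N : has_nf b M -> has_nf b N -> has_nf b (App M N).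
Proof.
intros (M' & HM & E) (N' & HN & E').
exists (App M' N'); split; [now constructor | now rewrite E, E'].
Qed.

Lemma has_nf_let b M N : has_nf b M -> has_nf b N -> has_nf b (Let M N).
Proof.
intros (M' & HM & E) (N' & HN & E').
exists (Let M' N'); split; [now constructor | now rewrite E, E'].
Qed.

Lemma has_nf_bang b q M : has_nf true M -> has_nf b (Bang q M).
Proof. intros (N & HN & E); exists (Bang q N); split; [now constructor | now rewrite E]. Qed.

Lemma has_nf_aud q M : has_nf true M -> has_nf true (q ▷ M).
Proof. intros (N & HN & E); exists (q ▷ N); split; [now constructor | now rewrite E]. Qed.

Lemma has_nf_iota b th : (forall i, has_nf b (get9 i th)) -> has_nf b (Iota th).
Proof.
intros H; destruct (nine_choice _ H) as [th' H'].
exists (Iota th'); split; [constructor | apply Iota_eq]; intro i; apply H'.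
Qed.

(** Stated for any class [S] closed under [lift], because it is used in two stages: first for
    renamings, which gives stability under [sUp], and then for [sub_nf], whose closure under [lift]
    rests on that stability. *)
Lemma nform_clos b M : nform b M ->
  forall S : subst -> Prop,
  (forall s, S s -> S (lift s)) ->
  (forall s n, S s -> has_nf b ((idx n)⟦s⟧)) ->
  forall s, S s -> has_nf b (M⟦s⟧).
Proof.
induction 1
  as [b n|b M _ IH|b M N _ IHM _ IHN|b M N _ IHM _ IHN
   |b q M _ IH|b q M Hb _ IH|b th _ IH];
  intros S HS Hidx s Hs.
- now apply Hidx.
- rewrite (sigma_eq _ _ (sg_lam _ _)); apply has_nf_lam, (IH S); auto.
- rewrite (sigma_eq _ _ (sg_app _ _ _)); apply has_nf_app; [apply (IHM S)|apply (IHN S)]; auto.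
- rewrite (sigma_eq _ _ (sg_let _ _ _)); apply has_nf_let; [apply (IHM S)|apply (IHN S)]; auto.
- rewrite (sigma_eq _ _ (sg_bang _ _ _)); apply has_nf_bang, (IH S); auto.
  (* The body of a bang is handled with flag [true], so the terms assigned to indices are weakened
     to that flag. *)
  intros; now apply (has_nf_weaken b), Hidx.
- subst b; rewrite (sigma_eq _ _ (sg_aud _ _ _)); apply has_nf_aud, (IH S); auto.
- rewrite clos_iota; apply has_nf_iota; intro i; rewrite get9_map9; apply (IH i S); auto.
Qed.

Lemma has_nf_sUp b M : has_nf b M -> has_nf b (M⟦sUp⟧).
Proof.
intros (N & HN & E); rewrite E.
(* The class of renamings: every index goes to an index, up to conversion. *)
apply (nform_clos b N HN (fun s => forall n, exists m, (idx n)⟦s⟧ ≡ idx m)).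
- intros s Hs [|n].
  + exists 0; apply sigma_eq, sg_one_cons.
  + destruct (Hs n) as [m Hm]; exists (S m).
    now rewrite idx_lift_S, Hm, idx_sUp.
- intros s n Hs; destruct (Hs n) as [m Hm]; rewrite Hm; apply nform_has_nf; constructor.
- intro n; exists (S n); apply idx_sUp.
Qed.

Definition sub_nf (b : bool) (s : subst) : Prop := forall n, has_nf b ((idx n)⟦s⟧).

Lemma sub_nf_lift b s : sub_nf b s -> sub_nf b (lift s).
Proof.
intros Hs [|n].
- unfold lift; simpl; rewrite (sigma_eq _ _ (sg_one_cons _ _)).
  apply nform_has_nf, (nf_idx b 0).
- rewrite idx_lift_S; apply has_nf_sUp, Hs.
Qed.

Lemma sub_nf_id b : sub_nf b sId.
Proof. intro n; rewrite idx_sId; apply nform_has_nf; constructor. Qed.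

Lemma sub_nf_cons b M s : has_nf b M -> sub_nf b s -> sub_nf b (M · s).
Proof.
intros HM Hs [|n].
- simpl; now rewrite (sigma_eq _ _ (sg_one_cons _ _)).
- rewrite idx_cons; apply Hs.
Qed.

Lemma has_nf_clos b M s : has_nf b M -> sub_nf b s -> has_nf b (M⟦s⟧).
Proof.
intros (N & HN & E) Hs; rewrite E.
apply (nform_clos b N HN (sub_nf b)); trivial.
apply sub_nf_lift.
Qed.

(** * Normal forms of all terms, and the effect of erasure on them *)

Lemma er_idx n : Er (idx n) ≡ idx n.
Proof. apply sigma_eq; destruct n; constructor. Qed.

Lemma er_iota th : Er (Iota th) ≡ Iota (map9 Er th).
Proof. apply sigma_eq, sg_er_iota. Qed.

Lemma nform_er b M : nform b M -> has_nf false (Er M).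
Proof.
induction 1
  as [b n|b M _ IH|b M N _ IHM _ IHN|b M N _ IHM _ IHN
   |b q M H IH|b q M Hb _ IH|b th _ IH].
- rewrite er_idx; apply nform_has_nf; constructor.
- rewrite (sigma_eq _ _ (sg_er_lam _)); now apply has_nf_lam.
- rewrite (sigma_eq _ _ (sg_er_app _ _)); now apply has_nf_app.
- rewrite (sigma_eq _ _ (sg_er_let _ _)); now apply has_nf_let.
- rewrite (sigma_eq _ _ (sg_er_bang _ _)); now apply has_nf_bang, nform_has_nf.
- now rewrite (sigma_eq _ _ (sg_er_aud _ _)).
- rewrite er_iota; apply has_nf_iota; intro i; rewrite get9_map9; apply IH.
Qed.

(** By mutual structural recursion: [Clos] and [Er] are eliminated over a body that already has a
    normal form, so termination of σ is not involved. *)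
Fixpoint has_nf_all (M : term) : has_nf true M
with sub_nf_all (s : subst) : sub_nf true s.
Proof.
- destruct M as [|M|M N|M N|q M|q M|th|M s|M].
  + apply nform_has_nf, (nf_idx true 0).
  + apply has_nf_lam, has_nf_all.
  + apply has_nf_app; apply has_nf_all.
  + apply has_nf_let; apply has_nf_all.
  + apply has_nf_bang, has_nf_all.
  + apply has_nf_aud, has_nf_all.
  (* Splitting the family lets the guard condition see its components as subterms. *)
  + apply has_nf_iota; destruct th; intros []; simpl; apply has_nf_all.
  + apply has_nf_clos; [apply has_nf_all | apply sub_nf_all].
  + destruct (has_nf_all M) as (N & HN & E); rewrite E.
    now apply (has_nf_weaken false), (nform_er true).
- destruct s as [| |M s|s t].
  + apply sub_nf_id.
  + intro n; rewrite idx_sUp; apply nform_has_nf; constructor.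
  + apply sub_nf_cons; [apply has_nf_all | apply sub_nf_all].
  (* A composition acts as two successive substitutions, so the index is normalised under [s]
     first. *)
  + intro n; rewrite <- (sigma_eq _ _ (sg_clos _ _ _)).
    apply has_nf_clos; [apply sub_nf_all | apply sub_nf_all].
Qed.

Lemma erased_er M : has_nf false (Er M).
Proof. destruct (has_nf_all M) as (N & HN & E); rewrite E; now apply (nform_er true). Qed.

Lemma er_erased M : has_nf false M -> Er M ≡ M.
Proof.
intros (N & HN & E); rewrite E; clear M E.
remember false as b eqn:Eb; induction HN
  as [b n|b M _ IH|b M N _ IHM _ IHN|b M N _ IHM _ IHN
   |b q M H IH|b q M Hb _ IH|b th _ IH].
- apply er_idx.
- rewrite (sigma_eq _ _ (sg_er_lam _)), IH; trivial; reflexivity.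
- rewrite (sigma_eq _ _ (sg_er_app _ _)), IHM, IHN; trivial; reflexivity.
- rewrite (sigma_eq _ _ (sg_er_let _ _)), IHM, IHN; trivial; reflexivity.
- apply sigma_eq, sg_er_bang.
- congruence.
- rewrite er_iota; apply Iota_eq; intro i; rewrite get9_map9; now apply IH.
Qed.

(** Every node yields a trail constructor applied to copies of [tR], which τ collapses. This is a
    reduction because it is later used to establish [nf_tr]. *)
Lemma tl_nform M : nform false M -> Tl M ↠ tR.
Proof.
intros HN.
remember false as b eqn:Eb; induction HN
  as [b n|b M _ IH|b M N _ IHM _ IHN|b M N _ IHM _ IHN
   |b q M H IH|b q M Hb _ IH|b th _ IH].
- apply sigma_tr_red; destruct n; constructor.
- rewrite (sigma_tr_red _ _ (sg_tl_lam _)), IH; trivial; apply tau_tr_red; constructor.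
- rewrite (sigma_tr_red _ _ (sg_tl_app _ _)), IHM, IHN; trivial; apply tau_tr_red; constructor.
- rewrite (sigma_tr_red _ _ (sg_tl_let _ _)), IHM, IHN; trivial; apply tau_tr_red; constructor.
- apply sigma_tr_red; constructor.
- congruence.
- rewrite (sigma_tr_red _ _ (sg_tl_iota _)), <- (tau_tr_red _ _ ta_tr_r).
  apply tTr_red; intro i; rewrite get9_map9, get9_const9; now apply IH.
Qed.

Lemma tl_erased M : has_nf false M -> Tl M ≡t tR.
Proof. intros (N & HN & E); rewrite E; now apply tr_red_eq, tl_nform. Qed.

(** * Moving audits outwards *)

Lemma aud_aud q q' M : q ▷ q' ▷ M ≡ tT q q' ▷ M.
Proof. apply tau_eq, ta_trans. Qed.
Lemma aud_r M : tR ▷ M ≡ M.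
Proof. apply tau_eq, ta_refl. Qed.
Lemma t_r q : tT q tR ≡t q.
Proof. apply tau_tr_eq, ta_t_r. Qed.
Lemma r_t q : tT tR q ≡t q.
Proof. apply tau_tr_eq, ta_r_t. Qed.
(** The audits are pulled out one after the other, leaving [tApp q tR] and [tApp tR q'], which merge
    componentwise. *)
Lemma app_aud q q' M N : App (q ▷ M) (q' ▷ N) ≡ tApp q q' ▷ App M N.
Proof.
now rewrite (tau_eq _ _ (ta_app_l _ _ _)), (tau_eq _ _ (ta_app_r _ _ _)), aud_aud,
  (tau_tr_eq _ _ (ta_app_app _ _ _ _)), t_r, r_t.
Qed.

Lemma let_aud q q' M N : Let (q ▷ M) (q' ▷ N) ≡ tLet q q' ▷ Let M N.
Proof.
now rewrite (tau_eq _ _ (ta_let_l _ _ _)), (tau_eq _ _ (ta_let_r _ _ _)), aud_aud,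
  (tau_tr_eq _ _ (ta_let_let _ _ _ _)), t_r, r_t.
Qed.

(** One round of the accumulation in [iota_aud]: position [i] of the outer trail is still empty and
    receives the audit of component [i]. *)
Lemma iota_aud_component i z q th : get9 i z = tR ->
  tTr z ▷ Iota (set9 i (q ▷ get9 i th) th) ≡ tTr (set9 i q z) ▷ Iota th.
Proof.
intros Hz; rewrite (tau_eq _ _ (ta_iota _ _ _)), aud_aud, (tau_tr_eq _ _ (ta_tr_tr _ _)).
rewrite (tTr_eq _ (set9 i q z)); [reflexivity|].
intro j; destruct i, z; simpl in Hz; subst; destruct j; simpl;
  (* At position [i] the old entry is [tR]; at every other position the new one is. *)
  first [apply r_t | apply t_r].
Qed.

Lemma iota_aud qs th : Iota (map2_9 Aud qs th) ≡ tTr qs ▷ Iota th.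
Proof.
destruct qs as [q1 q2 q3 q4 q5 q6 q7 q8 q9], th as [a1 a2 a3 a4 a5 a6 a7 a8 a9].
(* A trivial audit, written as the all-[tR] family, is the starting point of the accumulation; each
   round below fills its next position. *)
rewrite <- (aud_r (Iota _)), <- (tau_tr_eq _ _ ta_tr_r).
etransitivity.
{ exact (iota_aud_component c_r (const9 tR) q1 (Nine a1 (q2 ▷ a2) (q3 ▷ a3)
    (q4 ▷ a4) (q5 ▷ a5) (q6 ▷ a6) (q7 ▷ a7) (q8 ▷ a8) (q9 ▷ a9)) eq_refl). }
etransitivity.
{ exact (iota_aud_component c_t (Nine q1 tR tR tR tR tR tR tR tR) q2 (Nine a1 a2 (q3 ▷ a3)
    (q4 ▷ a4) (q5 ▷ a5) (q6 ▷ a6) (q7 ▷ a7) (q8 ▷ a8) (q9 ▷ a9)) eq_refl). }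
etransitivity.
{ exact (iota_aud_component c_ba (Nine q1 q2 tR tR tR tR tR tR tR) q3 (Nine a1 a2 a3
    (q4 ▷ a4) (q5 ▷ a5) (q6 ▷ a6) (q7 ▷ a7) (q8 ▷ a8) (q9 ▷ a9)) eq_refl). }
etransitivity.
{ exact (iota_aud_component c_bb (Nine q1 q2 q3 tR tR tR tR tR tR) q4 (Nine a1 a2 a3
    a4 (q5 ▷ a5) (q6 ▷ a6) (q7 ▷ a7) (q8 ▷ a8) (q9 ▷ a9)) eq_refl). }
etransitivity.
{ exact (iota_aud_component c_ti (Nine q1 q2 q3 q4 tR tR tR tR tR) q5 (Nine a1 a2 a3
    a4 a5 (q6 ▷ a6) (q7 ▷ a7) (q8 ▷ a8) (q9 ▷ a9)) eq_refl). }
etransitivity.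
{ exact (iota_aud_component c_lam (Nine q1 q2 q3 q4 q5 tR tR tR tR) q6 (Nine a1 a2 a3
    a4 a5 a6 (q7 ▷ a7) (q8 ▷ a8) (q9 ▷ a9)) eq_refl). }
etransitivity.
{ exact (iota_aud_component c_app (Nine q1 q2 q3 q4 q5 q6 tR tR tR) q7 (Nine a1 a2 a3
    a4 a5 a6 a7 (q8 ▷ a8) (q9 ▷ a9)) eq_refl). }
etransitivity.
{ exact (iota_aud_component c_let (Nine q1 q2 q3 q4 q5 q6 q7 tR tR) q8 (Nine a1 a2 a3
    a4 a5 a6 a7 a8 (q9 ▷ a9)) eq_refl). }
exact (iota_aud_component c_tr (Nine q1 q2 q3 q4 q5 q6 q7 q8 tR) q9
  (Nine a1 a2 a3 a4 a5 a6 a7 a8 a9) eq_refl).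
Qed.

(** On a normal form, the audits of the subterms given by induction move outwards by τ, and the
    trail they build is the one that [Tl] computes. At a bang, [Tl] gives [tR] and [Er] changes
    nothing. *)
Lemma aud_tl_er M : M ≡ Tl M ▷ Er M.
Proof.
destruct (has_nf_all M) as (N & HN & E); rewrite E; clear M E.
induction HN
  as [b n|b M _ IH|b M N _ IHM _ IHN|b M N _ IHM _ IHN
   |b q M H IH|b q M Hb _ IH|b th _ IH].
- rewrite er_idx, tl_erased, aud_r; [reflexivity | apply nform_has_nf; constructor].
- rewrite (sigma_tr_eq _ _ (sg_tl_lam _)), (sigma_eq _ _ (sg_er_lam _)),
    <- (tau_eq _ _ (ta_lam _ _)), <- IH; reflexivity.
- rewrite (sigma_tr_eq _ _ (sg_tl_app _ _)), (sigma_eq _ _ (sg_er_app _ _)),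
    <- app_aud, <- IHM, <- IHN; reflexivity.
- rewrite (sigma_tr_eq _ _ (sg_tl_let _ _)), (sigma_eq _ _ (sg_er_let _ _)),
    <- let_aud, <- IHM, <- IHN; reflexivity.
- now rewrite (sigma_tr_eq _ _ (sg_tl_bang _ _)), (sigma_eq _ _ (sg_er_bang _ _)), aud_r.
- rewrite (sigma_tr_eq _ _ (sg_tl_aud _ _)), (sigma_eq _ _ (sg_er_aud _ _)), <- aud_aud,
    <- IH; reflexivity.
- rewrite (sigma_tr_eq _ _ (sg_tl_iota _)), (sigma_eq _ _ (sg_er_iota _)), <- iota_aud.
  apply Iota_eq; intro i; rewrite get9_map2_9, !get9_map9; apply IH.
Qed.

(** The induction needs any [s] that fixes all indices: below a binder, [sId] becomes [lift sId]. *)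
Lemma nform_clos_id b M : nform b M ->
  forall s, (forall n, (idx n)⟦s⟧ ≡ idx n) -> M⟦s⟧ ≡ M.
Proof.
induction 1
  as [b n|b M _ IH|b M N _ IHM _ IHN|b M N _ IHM _ IHN
   |b q M H IH|b q M Hb _ IH|b th _ IH];
  intros s Hs;
  assert (Hl : forall n, (idx n)⟦lift s⟧ ≡ idx n) by
   (intros [|m]; [apply sigma_eq, sg_one_cons | now rewrite idx_lift_S, Hs, idx_sUp]).
- apply Hs.
- rewrite (sigma_eq _ _ (sg_lam _ _)), IH by trivial; reflexivity.
- rewrite (sigma_eq _ _ (sg_app _ _ _)), IHM, IHN by trivial; reflexivity.
- rewrite (sigma_eq _ _ (sg_let _ _ _)), IHM, IHN by trivial; reflexivity.
- rewrite (sigma_eq _ _ (sg_bang _ _ _)), IH by trivial; reflexivity.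
- rewrite (sigma_eq _ _ (sg_aud _ _ _)), IH by trivial; reflexivity.
- rewrite clos_iota; apply Iota_eq; intro i; rewrite get9_map9; now apply IH.
Qed.

Lemma clos_id M : M⟦sId⟧ ≡ M.
Proof.
destruct (has_nf_all M) as (N & HN & E); rewrite E.
apply (nform_clos_id true); trivial; apply idx_sId.
Qed.

Lemma env_id e : env e -> e ∘ sId ≡s e.
Proof.
induction 1 as [|V e _ _ IH]; [apply sigma_sb_eq, sg_id_l|].
now rewrite (sigma_sb_eq _ _ (sg_cons_comp _ _ _)), clos_id, IH.
Qed.

(** * Erasure and substitution *)

Lemma er_clos_app M N s : Er ((App M N)⟦s⟧) ≡ App (Er (M⟦s⟧)) (Er (N⟦s⟧)).
Proof. now rewrite (sigma_eq _ _ (sg_app _ _ _)), (sigma_eq _ _ (sg_er_app _ _)). Qed.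
Lemma er_clos_lam M s : Er ((Lam M)⟦s⟧) ≡ Lam (Er (M⟦lift s⟧)).
Proof. now rewrite (sigma_eq _ _ (sg_lam _ _)), (sigma_eq _ _ (sg_er_lam _)). Qed.
Lemma er_clos_let M N s : Er ((Let M N)⟦s⟧) ≡ Let (Er (M⟦s⟧)) (Er (N⟦lift s⟧)).
Proof. now rewrite (sigma_eq _ _ (sg_let _ _ _)), (sigma_eq _ _ (sg_er_let _ _)). Qed.
Lemma er_clos_bang q M s : Er ((Bang q M)⟦s⟧) ≡ Bang q (M⟦s⟧).
Proof. now rewrite (sigma_eq _ _ (sg_bang _ _ _)), (sigma_eq _ _ (sg_er_bang _ _)). Qed.
Lemma er_clos_aud q M s : Er ((q ▷ M)⟦s⟧) ≡ Er (M⟦s⟧).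
Proof. now rewrite (sigma_eq _ _ (sg_aud _ _ _)), (sigma_eq _ _ (sg_er_aud _ _)). Qed.
Lemma er_clos_iota th s : Er ((Iota th)⟦s⟧) ≡ Iota (map9 (fun M => Er (M⟦s⟧)) th).
Proof.
rewrite clos_iota, er_iota; apply Iota_eq; intro i; now rewrite !get9_map9.
Qed.

(** The condition on [s] keeps audits out of the right-hand side, where the substituted terms are
    not erased. *)
Lemma er_clos_erased M s : sub_nf false s -> Er (M⟦s⟧) ≡ (Er M)⟦s⟧.
Proof.
destruct (has_nf_all M) as (N & HN & E); rewrite E; clear M E; revert s.
induction HN
  as [b n|b M _ IH|b M N _ IHM _ IHN|b M N _ IHM _ IHN
   |b q M H IH|b q M Hb _ IH|b th _ IH];
  intros s Hs; assert (Hl := sub_nf_lift _ _ Hs).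
- rewrite er_idx; apply er_erased, Hs.
- rewrite er_clos_lam, IH, (sigma_eq _ _ (sg_er_lam _)), (sigma_eq _ _ (sg_lam _ _)) by trivial.
  reflexivity.
- rewrite er_clos_app, IHM, IHN, (sigma_eq _ _ (sg_er_app _ _)), (sigma_eq _ _ (sg_app _ _ _)) by trivial.
  reflexivity.
- rewrite er_clos_let, IHM, IHN, (sigma_eq _ _ (sg_er_let _ _)), (sigma_eq _ _ (sg_let _ _ _)) by trivial.
  reflexivity.
- now rewrite er_clos_bang, (sigma_eq _ _ (sg_er_bang _ _)), (sigma_eq _ _ (sg_bang _ _ _)).
- rewrite er_clos_aud, IH, (sigma_eq _ _ (sg_er_aud _ _)) by trivial; reflexivity.
- rewrite er_clos_iota, er_iota, clos_iota.
  apply Iota_eq; intro i; rewrite !get9_map9; now apply IH.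
Qed.

(** The outer erasure also covers the substituted terms, so here [s] is arbitrary. *)
Lemma er_clos_er M s : Er ((Er M)⟦s⟧) ≡ Er (M⟦s⟧).
Proof.
destruct (has_nf_all M) as (N & HN & E); rewrite E; clear M E; revert s.
induction HN
  as [b n|b M _ IH|b M N _ IHM _ IHN|b M N _ IHM _ IHN
   |b q M H IH|b q M Hb _ IH|b th _ IH];
  intros s.
- now rewrite er_idx.
- now rewrite (sigma_eq _ _ (sg_er_lam _)), !er_clos_lam, IH.
- now rewrite (sigma_eq _ _ (sg_er_app _ _)), !er_clos_app, IHM, IHN.
- now rewrite (sigma_eq _ _ (sg_er_let _ _)), !er_clos_let, IHM, IHN.
- now rewrite (sigma_eq _ _ (sg_er_bang _ _)).
- now rewrite (sigma_eq _ _ (sg_er_aud _ _)), er_clos_aud, IH.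
- rewrite er_iota, !er_clos_iota.
  apply Iota_eq; intro i; rewrite !get9_map9; apply IH.
Qed.

Lemma closure_erased C : closure C -> has_nf false C.
Proof. destruct 1; [apply erased_er | apply has_nf_bang, has_nf_all]. Qed.

Lemma value_erased q C : value (q ▷ C) -> has_nf false C.
Proof.
inversion 1; subst; [now apply closure_erased | apply has_nf_bang, has_nf_all].
Qed.

(** * Contexts *)

(** Turns the list-shaped [iota] frame of a stack into the [set9] form of the context grammars; the
    position is the length of [l], and the [d] in the hole is a placeholder. *)
Lemma of_list_hole {A} (d : A) (l l' : list A) : length l < 9 ->
  exists i, forall x, of_list d (l ++ x :: l') = set9 i x (of_list d (l ++ d :: l')).
Proof.
intros Hl.
destruct l as [|a1 l]; [now exists c_r|].
destruct l as [|a2 l]; [now exists c_t|].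
destruct l as [|a3 l]; [now exists c_ba|].
destruct l as [|a4 l]; [now exists c_bb|].
destruct l as [|a5 l]; [now exists c_ti|].
destruct l as [|a6 l]; [now exists c_lam|].
destruct l as [|a7 l]; [now exists c_app|].
destruct l as [|a8 l]; [now exists c_let|].
destruct l as [|a9 l]; [now exists c_tr|].
simpl in Hl; lia.
Qed.

Lemma to_list_of_list {A} (d : A) l : length l = 9 -> to_list (of_list d l) = l.
Proof.
intros H; do 9 (destruct l as [|? l]; [discriminate|]).
now destruct l.
Qed.

Lemma of_list_Forall2 {A B} (R : A -> B -> Prop) d d' l l' :
  R d d' -> Forall2 R l l' ->
  forall i, R (get9 i (of_list d l)) (get9 i (of_list d' l')).
Proof.
intros Hd Hl.
assert (H : forall n, R (nth n l d) (nth n l' d')).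
{ induction Hl; intros [|n]; simpl; auto. }
intros []; apply H.
Qed.

(** The top frame of a stack is the innermost part of the context, while the grammar grows outwards;
    hence the accumulator [G], which absorbs the frames from the hole outwards. *)
Lemma den_ctx_Ectx π D C : den_ctx π D C -> forall G, Ectx G ->
  exists E, Ectx E /\ forall X, E X = C (G X).
Proof.
induction 1 as [|q M e q' π D C _ IH|q π V D C _ IH|q M e π D C _ IH|q π D C _ IH|r q' π Vs D C Hl _ IH];
  intros G HG.
- now exists G.
- exact (IH _ (E_aud q' _ (E_app_l G _ HG))).
- exact (IH _ (E_aud q _ (E_app_r V G HG))).
- exact (IH _ (E_aud q _ (E_let_l G _ HG))).
- exact (IH _ (E_aud q _ (E_bang tR G HG))).
- destruct (of_list_hole One Vs (run_terms r)) as [i Hi]; [lia|].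
  destruct (IH _ (E_aud q' _ (E_iota i (of_list One (Vs ++ One :: run_terms r)) G HG)))
    as (E & HE & EQ).
  exists E; split; trivial; intro X; rewrite EQ; cbv beta; now rewrite (Hi (G X)).
Qed.

Lemma den_ctx_eq π D C : den_ctx π D C -> Proper (st_eq ==> st_eq) C.
Proof.
induction 1 as [|q M e q' π D C _ IH|q π V D C _ IH|q M e π D C _ IH|q π D C _ IH|r q' π Vs D C Hl _ IH];
  intros X Y H; trivial; try (apply IH; now rewrite H).
destruct (of_list_hole One Vs (run_terms r)) as [i Hi]; [lia|].
apply IH, Aud_eq; [reflexivity|]; rewrite (Hi X), (Hi Y).
apply Iota_eq; intro j.
destruct (of_list One (Vs ++ One :: run_terms r)), i, j; simpl; trivial; reflexivity.
Qed.

(** * Beta steps inside denotations, and returning a value *)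

Lemma cau_star_eq M N : M ≡ N -> cau_star M N.
Proof. intros; apply rt_step; now right. Qed.

Lemma cau_star_ctx_beta π D C G M M' N N' : den_ctx π D C -> Ectx G ->
  M ≡ G M' -> beta_rule M' N' -> G N' ≡ N -> cau_star (C M) (C N).
Proof.
intros HC HG EM Hb EN.
destruct (den_ctx_Ectx _ _ _ HC _ HG) as (E & HE & EQ).
eapply rt_trans; [apply cau_star_eq, (den_ctx_eq _ _ _ HC), EM|].
eapply rt_trans; [|apply cau_star_eq, (den_ctx_eq _ _ _ HC), EN].
rewrite <- !EQ; apply rt_step; left; now constructor.
Qed.

(** Returning a value leaves the denotation syntactically unchanged: each kind of frame, with its
    hole filled by [V], is the denotation of a term configuration. *)
Lemma den_tm_return π D C V : den_ctx π D C -> den_tm (π, V :: D) (C V).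
Proof.
destruct 1 as [|q M e q' π D C H|q π W D C H|q M e π D C H|q π D C H|r q' π Vs D C Hl H].
- constructor.
- exact (dt_term q M e _ _ _ (dc_app_r q' π V D C H)).
- exact (dt_app q π V W D C H).
- exact (dt_let q M e π V D C H).
- exact (dt_bang q π V D C H).
(* Either [V] is the ninth component and the [iota] tuple comes to the top, or the first pending
   component becomes the current term. *)
- destruct r as [|[[q M] e] r]; simpl in *.
  + assert (HV : to_list (of_list One (Vs ++ [V])) = Vs ++ [V])
      by (apply to_list_of_list; rewrite length_app; simpl; lia).
    replace (V :: rev Vs ++ D) with (rev (to_list (of_list One (Vs ++ [V]))) ++ D)
      by (rewrite HV, rev_app_distr; reflexivity).
    now apply dt_iota.
  + replace (V :: rev Vs ++ D) with (rev (Vs ++ [V]) ++ D)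
      by now rewrite rev_app_distr.
    assert (Hl' : length (Vs ++ [V]) + 1 + length r = 9) by (rewrite length_app; simpl; lia).
    generalize (dt_term q M e _ _ _ (dc_iota r q' π (Vs ++ [V]) D C Hl' H)).
    now rewrite <- app_assoc.
Qed.

Lemma Fctx_comp F G : Fctx F -> Fctx G -> Fctx (fun X => F (G X)).
Proof.
intros HF HG; induction HF.
- exact HG.
- now apply (F_lam (fun X => F (G X))).
- now apply (F_app_l (fun X => F (G X))).
- now apply (F_app_r _ (fun X => F (G X))).
- now apply (F_let_l (fun X => F (G X))).
- now apply (F_let_r _ (fun X => F (G X))).
- now apply (F_aud _ (fun X => F (G X))).
- now apply (F_iota _ _ (fun X => F (G X))).
- now apply (F_clos (fun X => F (G X))).
Qed.

(** * Trail materialization *)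

(** [nf_tr] asks for an actual reduction, whereas the trail of [Er (M⟦e⟧)] is
    only known up to conversion: hence the convertible [M']. *)
Definition carries (M : term) (q : trail) : Prop := exists M', M ≡ M' /\ Tl M' ↠ q.

Lemma carries_aud q M : has_nf false M -> carries (q ▷ M) q.
Proof.
intros (N & HN & E); exists (q ▷ N); split; [now rewrite E|].
rewrite (sigma_tr_red _ _ (sg_tl_aud _ _)), (tl_nform _ HN).
apply tau_tr_red, ta_t_r.
Qed.

Lemma carries_list l qs : Forall2 carries l qs ->
  exists l', Forall2 st_eq l l' /\ Forall2 (fun M q => Tl M ↠ q) l' qs.
Proof.
induction 1 as [|M q l qs (M' & HM & Hq) _ (l' & Hl & Hqs)].
- exists []; split; constructor.
- exists (M' :: l'); split; now constructor.
Qed.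

Lemma carries_run r : Forall2 carries (run_terms r) (run_trails r).
Proof.
induction r as [|[[q M] e] r IH]; constructor; trivial.
apply carries_aud, erased_er.
Qed.

Lemma tl_aud_red q M p : Tl M ↠ p -> Tl (q ▷ M) ↠ tT q p.
Proof. intros H; rewrite (sigma_tr_red _ _ (sg_tl_aud _ _)), H; reflexivity. Qed.

Local Ltac no_run :=
  match goal with
  | E : run_tuples ?r ++ _ = _ |- _ => destruct r as [|[[? ?] ?] [|[[? ?] ?] ?]]; discriminate
  | E : _ = run_tuples ?r ++ _ |- _ => destruct r as [|[[? ?] ?] [|[[? ?] ?] ?]]; discriminate
  end.

Lemma den_ctx_app_l_inv q M e q' π D C :
  den_ctx (Tup q (KTerm M) e :: Tup q' KApp sId :: π) D C ->
  exists C0, den_ctx π D C0 /\ C = fun X => C0 (q' ▷ App X (q ▷ Er (M⟦e⟧))).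
Proof. inversion 1; subst; try no_run; eexists; split; [eassumption|reflexivity]. Qed.

Lemma den_ctx_app_r_inv q π V D C : den_ctx (Tup q KApp sId :: π) (V :: D) C ->
  exists C0, den_ctx π D C0 /\ C = fun X => C0 (q ▷ App V X).
Proof. inversion 1; subst; try no_run; eexists; split; [eassumption|reflexivity]. Qed.

Lemma den_ctx_let_inv q M e π D C : den_ctx (Tup q (KLet M) e :: π) D C ->
  exists C0, den_ctx π D C0 /\ C = fun X => C0 (q ▷ Let X (Er (M⟦lift e⟧))).
Proof. inversion 1; subst; try no_run; eexists; split; [eassumption|reflexivity]. Qed.

Lemma den_ctx_bang_inv q π D C : den_ctx (Tup q KBang sId :: π) D C ->
  exists C0, den_ctx π D C0 /\ C = fun X => C0 (q ▷ Bang tR X).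
Proof. inversion 1; subst; try no_run; eexists; split; [eassumption|reflexivity]. Qed.

Lemma den_ctx_iota_inv r q π Vs D C : length Vs + 1 + length r = 9 ->
  den_ctx (run_tuples r ++ Tup q KIota sId :: π) (rev Vs ++ D) C ->
  exists C0, den_ctx π D C0 /\
    C = fun X => C0 (q ▷ Iota (of_list One (Vs ++ X :: run_terms r))).
Proof.
intros Hl H; inversion H; subst; try no_run.
match goal with E : run_tuples _ ++ _ = _ |- _ =>
  apply run_tuples_inj in E; destruct E as (-> & -> & ->) end.
match goal with E : rev _ ++ _ = rev _ ++ _ |- _ =>
  apply rev_app_inj in E; [destruct E as (-> & ->) | lia] end.
eexists; split; [eassumption|reflexivity].
Qed.

(** Materialization walks outwards to the nearest bang; [F] collects the frames passed on the way.
    Its accumulator [p] is the trail of what fills the hole, and each frame turns it into the trail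
    of the filled frame, which fills the hole of the next one. *)
Lemma materialize_ctx p π D q : materialize p π D q -> Forall value D ->
  forall C, den_ctx π D C ->
  exists E F, Ectx E /\ Fctx F /\ (forall X, C X ≡ E (Bang tR (F X))) /\
    (forall X, Tl X ↠ p -> nf_tr (Tl (F X)) q).
Proof.
induction 1 as [p q q' π D Hnf|p q q' M e q'' π D _ IH|p q q' q'' A π D _ IH
  |p q q' M e π D _ IH|p q r q' π qCs D Hl _ IH]; intros HD C HC.
- apply den_ctx_bang_inv in HC; destruct HC as (C0 & HC & ->).
  destruct (den_ctx_Ectx _ _ _ HC _ (E_aud q' _ E_hole)) as (E & HE & EQ).
  exists E, (fun X => X); split; [trivial|]; split; [constructor|]; split.
  + intro X; now rewrite EQ.
  + intros X HX; split; [|apply Hnf].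
    transitivity p; [exact HX | apply Hnf].
- apply den_ctx_app_l_inv in HC; destruct HC as (C0 & HC & ->).
  destruct (IH HD _ HC) as (E & F & HE & HF & EQ & Hq).
  (* The sibling is replaced by a convertible [N] whose trail really reduces to [q']. *)
  destruct (carries_aud q' _ (erased_er (M⟦e⟧))) as (N & EN & HN).
  exists E, (fun X => F (q'' ▷ App X N)); split; [trivial|]; split; [|split].
  + apply (Fctx_comp _ _ HF), (F_aud q'' _ (F_app_l _ N F_hole)).
  + intro X; rewrite <- EQ; apply (den_ctx_eq _ _ _ HC); now rewrite EN.
  + intros X HX; apply Hq, tl_aud_red.
    now rewrite (sigma_tr_red _ _ (sg_tl_app _ _)), HX, HN.
- apply den_ctx_app_r_inv in HC; destruct HC as (C0 & HC & ->).
  inversion HD as [|? ? HV HD']; subst.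
  destruct (IH HD' _ HC) as (E & F & HE & HF & EQ & Hq).
  destruct (carries_aud q'' A) as (N & EN & HN); [now apply (value_erased q'')|].
  exists E, (fun X => F (q' ▷ App N X)); split; [trivial|]; split; [|split].
  + apply (Fctx_comp _ _ HF), (F_aud q' _ (F_app_r N _ F_hole)).
  + intro X; rewrite <- EQ; apply (den_ctx_eq _ _ _ HC); now rewrite EN.
  + intros X HX; apply Hq, tl_aud_red.
    now rewrite (sigma_tr_red _ _ (sg_tl_app _ _)), HX, HN.
- apply den_ctx_let_inv in HC; destruct HC as (C0 & HC & ->).
  destruct (IH HD _ HC) as (E & F & HE & HF & EQ & Hq).
  destruct (erased_er (M⟦lift e⟧)) as (N & HN & EN).
  exists E, (fun X => F (q' ▷ Let X N)); split; [trivial|]; split; [|split].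
  + apply (Fctx_comp _ _ HF), (F_aud q' _ (F_let_l _ N F_hole)).
  + intro X; rewrite <- EQ; apply (den_ctx_eq _ _ _ HC); now rewrite EN.
  + intros X HX; apply Hq, tl_aud_red.
    now rewrite (sigma_tr_red _ _ (sg_tl_let _ _)), HX, (tl_nform _ HN).
- apply den_ctx_iota_inv in HC; [|now rewrite length_map]; destruct HC as (C0 & HC & ->).
  apply Forall_app in HD; destruct HD as [HV HD].
  destruct (IH HD _ HC) as (E & F & HE & HF & EQ & Hq).
  destruct (carries_list _ _ (carries_run r)) as (Ns & HNs & HNq).
  destruct (carries_list (map (fun '(q, A) => q ▷ A) qCs) (map fst qCs))
    as (Ws & HWs & HWq).
  { apply Forall_rev in HV; rewrite rev_involutive in HV.
    clear - HV; induction qCs as [|[q A] qCs IH]; inversion HV; subst; constructor; auto.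
    apply carries_aud; now apply (value_erased q). }
  assert (HlW : length Ws < 9)
    by (apply Forall2_length in HWs; rewrite length_map in HWs; lia).
  destruct (of_list_hole One Ws Ns HlW) as [i Hi].
  exists E, (fun X => F (q' ▷ Iota (set9 i X (of_list One (Ws ++ One :: Ns)))));
    split; [trivial|]; split; [|split].
  + apply (Fctx_comp _ _ HF), (F_aud q' _ (F_iota i _ _ F_hole)).
  + intro X; rewrite <- EQ, <- Hi; apply (den_ctx_eq _ _ _ HC), Aud_eq; [reflexivity|].
    apply Iota_eq, of_list_Forall2; [reflexivity|].
    apply Forall2_app; [|constructor]; trivial; reflexivity.
  + intros X HX; apply Hq, tl_aud_red; rewrite <- Hi, (sigma_tr_red _ _ (sg_tl_iota _)).
    apply tTr_red; intro j; rewrite get9_map9; revert j.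
    (* The default entries [One] and [tR] must be related as well. *)
    apply (of_list_Forall2 (fun M p => Tl M ↠ p)); [apply (tl_nform One), (nf_idx false 0)|].
    apply Forall2_app; [|constructor]; trivial.
Qed.

(** * Machine steps *)

(** Lookup drops the trail of the value it finds, and so does the erasure. *)
Lemma er_lookup e n A : lookup e n = Some A -> Er ((idx n)⟦e⟧) ≡ Er A.
Proof.
revert n; induction e as [| |V e IH|]; intros n H; try (destruct n; discriminate).
destruct n as [|n].
- destruct V; try discriminate; injection H as ->; simpl.
  now rewrite (sigma_eq _ _ (sg_one_cons _ _)), (sigma_eq _ _ (sg_er_aud _ _)).
- rewrite idx_cons; apply IH; simpl in H; now destruct V.
Qed.

Lemma lookup_erased e n A : env e -> lookup e n = Some A -> has_nf false A.
Proof.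
intros He; revert n; induction He as [|V e HV He IH]; intros n H; [now destruct n|].
destruct n as [|n].
- destruct HV; injection H as <-; [now apply closure_erased | apply has_nf_bang, has_nf_all].
- apply (IH n); simpl in H; now destruct HV.
Qed.

(** [interp] builds only applications around the entries of the family, and substitution and erasure
    pass through applications. With indices for [th], this identifies an encoded trail run in an
    environment with the trail's interpretation. *)
Lemma interp_clos th th' e q M :
  (forall i, Er ((get9 i th)⟦e⟧) ≡ get9 i th') -> interp th q M ->
  exists M', interp th' q M' /\ Er (M⟦e⟧) ≡ M'.
Proof.
intros Hth; induction 1 as [|q1 q2 M1 M2 _ (M1' & H1 & E1) _ (M2' & H2 & E2)| | |
  |q1 M1 _ (M1' & H1 & E1)|q1 q2 M1 M2 _ (M1' & H1 & E1) _ (M2' & H2 & E2)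
  |q1 q2 M1 M2 _ (M1' & H1 & E1) _ (M2' & H2 & E2)|z Ms _ IH];
  try (eexists; split; [constructor; eassumption|];
       rewrite ?er_clos_app, ?E1, ?E2, ?Hth; reflexivity).
destruct (nine_choice _ IH) as [Ms' H].
exists (fold_left App (to_list Ms') (get9 c_tr th')); split.
- constructor; intro i; apply H.
- assert (HE : forall i, Er ((get9 i Ms)⟦e⟧) ≡ get9 i Ms') by apply H.
  destruct Ms as [a1 a2 a3 a4 a5 a6 a7 a8 a9], Ms' as [b1 b2 b3 b4 b5 b6 b7 b8 b9].
  cbn [to_list fold_left]; rewrite !er_clos_app, Hth.
  rewrite <- (HE c_r), <- (HE c_t), <- (HE c_ba), <- (HE c_bb), <- (HE c_ti),
    <- (HE c_lam), <- (HE c_app), <- (HE c_let), <- (HE c_tr); reflexivity.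
Qed.

Lemma step_beta_cau q q' q'' M e A π D C :
  den_ctx π D C -> env e -> has_nf false A ->
  cau_star (C (q ▷ App (q'' ▷ Er ((Lam M)⟦e⟧)) (q' ▷ A)))
           (C ((q ;; tApp q'' q' ;; tBa) ▷ Er (M⟦(tR ▷ A) · e⟧))).
Proof.
intros HC He HA; set (P := Er (M⟦lift e⟧)).
assert (HP : has_nf false P) by apply erased_er.
(* The trails of the frame and of both values are gathered outside, leaving a bare redex. *)
eapply (cau_star_ctx_beta _ _ _ (fun X => (q ;; tApp q'' q') ▷ X) _ (App (Lam P) A) _ _
  HC (E_aud _ _ E_hole)); [|apply beta_lam|].
- now rewrite er_clos_lam, app_aud, aud_aud.
(* Both parts of the redex are erased, so the trail created by Beta shrinks to [tBa]. *)
- rewrite (tl_erased _ HP), (tl_erased _ HA), (tau_tr_eq _ _ ta_lam_r),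
    (tau_tr_eq _ _ ta_app_rr), r_t, aud_aud, (er_erased _ HP), (er_erased _ HA); unfold P.
  rewrite <- er_clos_erased by (apply sub_nf_cons; [exact HA | apply sub_nf_id]).
  rewrite (sigma_eq _ _ (sg_clos _ _ _)), (lift_cons _ _ (env_id _ He)), aud_r; reflexivity.
Qed.

Lemma step_let_bang_cau q q' N e V π D C : den_ctx π D C -> env e ->
  cau_star (C (q ▷ Let (q' ▷ Bang tR V) (Er (N⟦lift e⟧))))
    (C ((q ;; tLet q' tR ;; tBb ;; Tl ((Er (N⟦lift e⟧))⟦V · sId⟧)) ▷ Er (N⟦V · e⟧))).
Proof.
intros HC He; set (P := Er (N⟦lift e⟧)).
assert (HP : has_nf false P) by apply erased_er.
eapply (cau_star_ctx_beta _ _ _ (fun X => (q ;; tLet q' tR) ▷ X) _ (Let (Bang tR V) P) _ _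
  HC (E_aud _ _ E_hole)); [|apply beta_let|].
- now rewrite (tau_eq _ _ (ta_let_l _ _ _)), aud_aud.
- rewrite (tl_erased _ HP), (tau_tr_eq _ _ ta_let_rr), r_t, aud_aud, (er_erased _ HP), aud_r.
  (* Unlike in the beta step, [V] may carry a trail, which surfaces wherever it is substituted; the
     result is split into the extracted trail recorded by the machine and an erased term. *)
  rewrite (aud_tl_er (P⟦V · sId⟧)) at 1; rewrite aud_aud; unfold P.
  rewrite er_clos_er, (sigma_eq _ _ (sg_clos _ _ _)), (lift_cons _ _ (env_id _ He)).
  reflexivity.
Qed.

Definition iota_env (Cs : nine term) : subst :=
  fold_right (fun A e => (tR ▷ A) · e) sId (to_list Cs).

Lemma step_ti_cau q qs Cs q' M π D C :
  den_ctx π D C -> Forall value D -> (forall i, has_nf false (get9 i Cs)) ->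
  materialize (q ;; tTr qs) π D q' -> encode q' M ->
  cau_star (C (q ▷ Iota (map2_9 Aud qs Cs)))
           (C ((q ;; tTr qs ;; tTi) ▷ Er (M⟦iota_env Cs⟧))).
Proof.
intros HC HD HCs Hq HM.
(* The components are exchanged for normal forms, whose trails reduce to [tR] and are not merely
   convertible to it. *)
destruct (nine_choice _ HCs) as [Ns HNs].
destruct (materialize_ctx _ _ _ _ Hq HD _ HC) as (E & F & HE & HF & EQ & Hnf).
assert (HM' : exists M', interp Ns q' M' /\ Er (M⟦iota_env Cs⟧) ≡ M').
{ revert HM; apply interp_clos; intro i.
  rewrite <- (proj2 (HNs i)), <- (er_erased _ (HCs i)).
  (* [idx] counts from 0, so the constructor numbered k+1 looks up entry k of [iota_env Cs]. *)
  destruct Cs, i; [now apply (er_lookup _ 0)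
   |now apply (er_lookup _ 1)
   |now apply (er_lookup _ 2)
   |now apply (er_lookup _ 3)
   |now apply (er_lookup _ 4)
   |now apply (er_lookup _ 5)
   |now apply (er_lookup _ 6)
   |now apply (er_lookup _ 7)
   |now apply (er_lookup _ 8)]. }
destruct HM' as (M' & Hi & EM).
apply rt_trans with (E (Bang tR (F ((q ;; tTr qs) ▷ Iota Ns)))).
{ apply cau_star_eq; rewrite <- EQ; apply (den_ctx_eq _ _ _ HC).
  rewrite iota_aud, aud_aud, (Iota_eq Cs Ns); [reflexivity | intro i; apply HNs]. }
apply rt_trans with (E (Bang tR (F ((q ;; tTr qs) ▷ tTi ▷ M')))).
- apply rt_step; left; constructor; trivial.
  apply (beta_ti tR (fun X => F ((q ;; tTr qs) ▷ X)) Ns q' M'); trivial.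
  + apply (Fctx_comp _ _ HF), (F_aud _ _ F_hole).
  + destruct (Hnf ((q ;; tTr qs) ▷ Iota Ns)) as [Hred Hirr].
    * rewrite (sigma_tr_red _ _ (sg_tl_aud _ _)), (tl_nform (Iota Ns)).
      -- apply tau_tr_red, ta_t_r.
      -- constructor; intro i; apply HNs.
    * split; [|exact Hirr].
      (* The rule prefixes the trail of the bang, which is [tR] for a machine frame. *)
      eapply rt_trans; [apply tau_tr_red, ta_r_t | exact Hred].
- apply cau_star_eq; rewrite <- EQ; apply (den_ctx_eq _ _ _ HC).
  now rewrite aud_aud, EM.
Qed.

(** The first component is the current term, the other eight form the run, and no value has been
    computed yet. *)
Lemma den_tm_iota_start q th e π D C : den_ctx π D C ->
  den_tm (map (fun M => Tup tR (KTerm M) e) (to_list th) ++ Tup q KIota sId :: π, D)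
    (C (q ▷ Iota (map9 (fun M => tR ▷ Er (M⟦e⟧)) th))).
Proof.
intros HC; destruct th as [a1 a2 a3 a4 a5 a6 a7 a8 a9].
exact (dt_term tR a1 e _ _ _
  (dc_iota (map (fun M => (tR, M, e)) [a2; a3; a4; a5; a6; a7; a8; a9]) q π [] D C eq_refl HC)).
Qed.

Theorem theorem5 (c c' : config) :
  valid c -> step c c' ->
  exists M M' : term, den_tm c M /\ den_tm c' M' /\ cau_star M M'.
Proof.
intros ([Hpi HD] & Hwf & _) Hstep.
destruct Hstep as [q M N e π D|q q' A q'' M e π D|q M e π D|q M N e π D
  |q q' N e V π D HV|q q' M e π D|q V π D|q th e π D|q qs Cs π D q' M Hm HM
  |q n e A π D Hn]; simpl in Hpi, HD;
  assert (Ht := Forall_inv Hpi); simpl in Ht; destruct Ht as [He _];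
  inversion Hwf; subst;
  try (match goal with H : wf_ctx ?π ?D |- _ =>
    destruct (wf_ctx_den _ _ H) as [C HC]; clear H end).
- eexists _, _; split; [exact (dt_term _ _ _ _ _ _ HC)|]; split.
  + exact (dt_term _ _ _ _ _ _ (dc_app_l _ _ _ _ _ _ _ HC)).
  + apply cau_star_eq, (den_ctx_eq _ _ _ HC); now rewrite er_clos_app, !aud_r.
- inversion HD as [|? ? HA HD']; subst; inversion HD' as [|? ? HL HD'']; subst.
  eexists _, _; split; [exact (dt_app _ _ _ _ _ _ HC)|]; split.
  + exact (dt_term _ _ _ _ _ _ HC).
  (* The environment here belongs to the closure on the dump; inverting that value shows it to be a
     proper one. *)
  + apply (step_beta_cau _ _ _ _ _ _ _ _ _ HC); [|now apply (value_erased q')].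
    inversion HL; subst. match goal with H : closure _ |- _ => now inversion H end.
- eexists _, _; split; [exact (dt_term _ _ _ _ _ _ HC)|]; split.
  + exact (den_tm_return _ _ _ _ HC).
  + apply rt_refl.
- eexists _, _; split; [exact (dt_term _ _ _ _ _ _ HC)|]; split.
  + exact (dt_term _ _ _ _ _ _ (dc_let _ _ _ _ _ _ HC)).
  + apply cau_star_eq, (den_ctx_eq _ _ _ HC); now rewrite er_clos_let, aud_r.
- eexists _, _; split; [exact (dt_let _ _ _ _ _ _ _ HC)|]; split.
  + exact (dt_term _ _ _ _ _ _ HC).
  + exact (step_let_bang_cau _ _ _ _ _ _ _ _ HC He).
- eexists _, _; split; [exact (dt_term _ _ _ _ _ _ HC)|]; split.
  + exact (dt_term _ _ _ _ _ _ (dc_bang _ _ _ _ HC)).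
  + apply cau_star_eq, (den_ctx_eq _ _ _ HC).
    (* The audit [q' ;; Tl (M⟦e⟧)] is absorbed by the bang; its second half is then released inside
       again and reunited with the erased body. *)
    rewrite er_clos_bang, (tau_eq _ _ (ta_bang _ _ _)), r_t,
      <- (tau_eq _ _ (ta_bang _ _ _)), <- aud_tl_er; reflexivity.
- eexists _, _; split; [exact (dt_bang _ _ _ _ _ HC)|]; split.
  + exact (den_tm_return _ _ _ _ HC).
  + apply rt_refl.
- eexists _, _; split; [exact (dt_term _ _ _ _ _ _ HC)|]; split.
  + exact (den_tm_iota_start _ _ _ _ _ _ HC).
  + apply cau_star_eq, (den_ctx_eq _ _ _ HC), Aud_eq; [reflexivity|].
    rewrite er_clos_iota; apply Iota_eq; intro i; now rewrite !get9_map9, aud_r.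
- match goal with E : rev _ ++ _ = _ |- _ =>
    apply rev_app_inj in E; [destruct E as [E ->]; apply to_list_inj in E; subst Vs
      | now destruct Vs, (map2_9 Aud qs Cs)] end.
  apply Forall_app in HD; destruct HD as [HV HD].
  eexists _, _; split; [exact (dt_iota _ _ _ _ _ HC)|]; split.
  + exact (dt_term _ _ _ _ _ _ HC).
  + apply (step_ti_cau _ _ _ q' _ _ _ _ HC HD); trivial.
    apply Forall_rev in HV; rewrite rev_involutive, Forall_forall in HV.
    intro i; apply (value_erased (get9 i qs)), HV; rewrite <- get9_map2_9.
    destruct (map2_9 Aud qs Cs), i; simpl; tauto.
- eexists _, _; split; [exact (dt_term _ _ _ _ _ _ HC)|]; split.
  + exact (den_tm_return _ _ _ _ HC).
  + apply cau_star_eq, (den_ctx_eq _ _ _ HC).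
    now rewrite (er_lookup _ _ _ Hn), (er_erased _ (lookup_erased _ _ _ He Hn)).
Qed.
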